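(* Let $G$ be a connected graph containing none of the bull, the claw, or $C_5$ as an induced subgraph. Then at least one of the following holds: (i) $G$ contains $K_6$; (ii) $G$ contains $\overline{C}_7\oplus K_2$; (iii) $G$ contains $\overline{C}_9\oplus K_1$; (iv) $\alpha(G)=2$ and $|V(G)|\geq 11$; (v) $\alpha(G)=2$ and $\Delta(G)\geq 9$; (vi) $G$ is (isomorphic to) a clique expansion $C_{2n+1}[k_1,\ldots,k_{2n+1}]$ for some $n\geq1$ with $k_1+\cdots+k_{2n+1}-5n>0$; (vii) $G$ is $5$-colorable.
   Context: A bull is the graph with vertices $v_1,\ldots,v_5$ and edges $v_1v_2,v_2v_3,v_3v_4,v_4v_5,v_2v_4$; a claw is $K_{1,3}$. ''$G$ contains $H$'' means $G$ has a (not necessarily induced) subgraph isomorphic to $H$. $\overline{C}_m$ is the complement of the $m$-cycle. $G\oplus H$ denotes the join of $G$ and $H$: disjoint union plus all edges between $V(G)$ and $V(H)$. $\alpha(G)$ is the independence number and $\Delta(G)$ the maximum degree. For $p\geq 3$ and positive integers $k_1,\ldots,k_p$, the clique expansion $C_p[k_1,\ldots,k_p]$ replaces vertex $v_i$ of the cycle $v_1\ldots v_p$ by a clique of size $k_i$, with complete adjacency between cliques of cyclically consecutive vertices and no edges between other distinct cliques. *)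

(* Defs.v *)
From mathcomp Require Import all_boot.
Set Implicit Arguments.
Unset Strict Implicit.
Unset Printing Implicit Defensive.

Record sgraph := SGraph {
  vertex :> finType;
  edge : rel vertex;
  edge_sym : symmetric edge;
  edge_irrefl : irreflexive edge }.

Notation "x -- y" := (edge x y) (at level 30).

Fact graph_of_sym (T : finType) (e : rel T) :
  symmetric [rel x y | (x != y) && (e x y || e y x)].
Proof. by move=> x y /=; rewrite eq_sym orbC. Qed.

Fact graph_of_irrefl (T : finType) (e : rel T) :
  irreflexive [rel x y | (x != y) && (e x y || e y x)].
Proof. by move=> x /=; rewrite eqxx. Qed.

(* Distinct x and y are adjacent when e relates them in at least one
   direction, so e need be neither symmetric nor irreflexive. *)
Definition graph_of (T : finType) (e : rel T) : sgraph :=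
  SGraph (graph_of_sym e) (graph_of_irrefl e).

Definition complete_graph (n : nat) : sgraph :=
  graph_of (fun _ _ : 'I_n => true).

(* ordS is the cyclic successor; this is the n-cycle for n >= 3. *)
Definition cycle_graph (n : nat) : sgraph :=
  graph_of (fun i j : 'I_n => j == ordS i).

Definition complete_bipartite (m n : nat) : sgraph :=
  graph_of (fun u v : 'I_m + 'I_n =>
    match u, v with inl _, inr _ => true | _, _ => false end).

Definition claw : sgraph := complete_bipartite 1 3.

(* The vertex v_i is the ordinal i - 1. *)
Definition bull : sgraph :=
  graph_of (fun i j : 'I_5 =>
    (val i, val j) \in [:: (0, 1); (1, 2); (2, 3); (3, 4); (1, 3)]).

Definition compl_graph (G : sgraph) : sgraph :=
  graph_of (fun x y : G => ~~ (x -- y)).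

Definition join_graph (G H : sgraph) : sgraph :=
  graph_of (fun u v : G + H =>
    match u, v with
    | inl x, inl y => x -- y
    | inr x, inr y => x -- y
    | _, _ => true
    end).

(* A vertex is a pair of an index i of the p-cycle and an element of the
   clique of size k i. *)
Definition clique_expansion (p : nat) (k : 'I_p -> nat) : sgraph :=
  graph_of (fun u v : {i : 'I_p & 'I_(k i)} =>
    (tag u == tag v) || edge (tag u : cycle_graph p) (tag v)).

Definition contains (G H : sgraph) : Prop :=
  exists f : H -> G, injective f /\ forall x y : H, x -- y -> f x -- f y.

Definition contains_induced (G H : sgraph) : Prop :=
  exists f : H -> G, injective f /\ forall x y : H, f x -- f y = x -- y.

Definition isomorphic (G H : sgraph) : Prop :=
  exists f : H -> G, bijective f /\ forall x y : H, f x -- f y = x -- y.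

Definition connected (G : sgraph) : Prop :=
  forall x y : G, connect (@edge G) x y.

Definition independent (G : sgraph) (S : {set G}) : bool :=
  [forall x in S, forall y in S, ~~ (x -- y)].

Definition independence_number (G : sgraph) : nat :=
  \max_(S : {set G} | independent S) #|S|.

Definition degree (G : sgraph) (x : G) : nat := #|[set y : G | x -- y]|.

Definition max_degree (G : sgraph) : nat := \max_(x : G) degree x.

Definition colorable (k : nat) (G : sgraph) : Prop :=
  exists c : G -> 'I_k, forall x y : G, x -- y -> c x != c y.

(* Main.v *)
(* Suppose some three vertices of G are pairwise nonadjacent.  Then G has an
   induced path on five vertices: otherwise every induced path on three
   vertices dominates G, which a claw at a vertex between N[a] and its
   complement contradicts.  Relative to a longest induced path p_1 ... p_k
   (k >= 5) every vertex looks like one of the p_i or like a vertex closing the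
   path into a hole, so G is a clique expansion of C_(k+1) in which the class of
   closing vertices may be empty.  Such an expansion with cliques of size at
   most 5 and at most 5 * floor((k+1)/2) vertices is coloured by arcs of Z/5;
   with more vertices, k+1 is odd and no class is empty.

   Otherwise let H be the complement of G, which is triangle-free.  If H is
   bipartite, Hall's theorem extends an injective colouring of one side to the
   other.  If not, a shortest odd closed walk of H is a hole of length 7 or 9,
   and the at most three remaining vertices are matched with it or give one of
   the forbidden joins. *)
Require Import Defs.
From mathcomp Require Import all_boot.
From mathcomp Require Import zify.
From Stdlib Require Import Classical.
Set Implicit Arguments.
Unset Strict Implicit.
Unset Printing Implicit Defensive.

(** * Forbidden induced subgraphs *)

(** Closed adjacency suits clique expansions: it depends only on the classes of the two vertices,
    even when the vertices coincide. *)
Definition cadj (G : sgraph) (x y : G) := (x == y) || (x -- y).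

Lemma cadjC (G : sgraph) : symmetric (@cadj G).
Proof. by move=> x y; rewrite /cadj eq_sym edge_sym. Qed.

Lemma cadjxx (G : sgraph) (x : G) : cadj x x.
Proof. by rewrite /cadj eqxx. Qed.

Lemma edge_neq (G : sgraph) (x y : G) : x -- y -> x != y.
Proof. by apply: contraTneq => ->; rewrite edge_irrefl. Qed.

Lemma edge_cadj (G : sgraph) (x y : G) : x -- y = (x != y) && cadj x y.
Proof. by rewrite /cadj; case: eqVneq => [->|] //=; rewrite edge_irrefl. Qed.

(** Coinciding vertices satisfy the [cadj] disjunction, so distinctness of the named vertices is
    built into this form. *)
Definition claw_free (G : sgraph) := forall c x y z : G,
  c -- x -> c -- y -> c -- z -> [|| cadj x y, cadj x z | cadj y z].

Definition bull_free (G : sgraph) := forall a b c d e : G,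
  a -- b -> b -- c -> c -- d -> d -- e -> b -- d ->
  [|| cadj a c, cadj a d, cadj a e, cadj b e | cadj c e].

Definition C5_free (G : sgraph) := forall a b c d e : G,
  a -- b -> b -- c -> c -- d -> d -- e -> e -- a ->
  [|| cadj a c, cadj a d, cadj b d, cadj b e | cadj c e].

Lemma claw_freeP (G : sgraph) : ~ contains_induced G claw -> claw_free G.
Proof.
move=> H c x y z cx cy cz; apply: contra_notT H.
rewrite /cadj !negb_or => /and3P[/andP[xy xy'] /andP[xz xz'] /andP[yz yz']].
have [nx ny nz] := And3 (edge_neq cx) (edge_neq cy) (edge_neq cz).
exists (fun u : 'I_1 + 'I_3 =>
  match u with inl _ => c | inr i => nth x [:: x; y; z] (val i) end).
split.
  move=> [i|[[|[|[|//]]] ?]] [j|[[|[|[|//]]] ?]] //= E; try congr inr;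
    try (by congr inl; apply/val_inj; case: (i) (j) => [[]] // ? [[]]);
    try (by apply/val_inj);
   by move: nx ny nz xy xz yz; rewrite E eqxx.
move=> [[[|//] ?]|[[|[|[|//]]] ?]] [[[|//] ?]|[[|[|[|//]]] ?]] //=;
  rewrite ?edge_irrefl ?cx ?cy ?cz ?(negbTE xy') ?(negbTE yz') ?(negbTE xz') //;
  by rewrite edge_sym ?cx ?cy ?cz ?(negbTE xy') ?(negbTE yz') ?(negbTE xz').
Qed.

Lemma induced5 (G : sgraph) (e : rel 'I_5) (a b c d f : G) :
  uniq [:: a; b; c; d; f] ->
  (forall i j : 'I_5, i < j ->
     nth a [:: a; b; c; d; f] i -- nth a [:: a; b; c; d; f] j =
       e i j || e j i) ->
  contains_induced G (graph_of e).
Proof.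
move=> U E; exists (fun i : 'I_5 => nth a [:: a; b; c; d; f] i); split.
  move=> i j /eqP; rewrite nth_uniq ?ltn_ord // => /eqP; exact: val_inj.
move=> i j; rewrite [RHS]/=; case: (ltngtP i j) => ij.
- by rewrite E // -val_eqE neq_ltn ij.
- by rewrite edge_sym E // orbC -val_eqE neq_ltn ij orbT.
- by rewrite (val_inj ij) edge_irrefl eqxx.
Qed.

Lemma bull_freeP (G : sgraph) : ~ contains_induced G bull -> bull_free G.
Proof.
move=> H a b c d e ab bc cd de bd; apply: contra_notT H.
rewrite /cadj !negb_or => /and5P[/andP[ac ac'] /andP[ad ad'] /andP[ae ae']
  /andP[be be'] /andP[ce ce']].
apply: (@induced5 _ _ a b c d e).
  rewrite /= !inE !negb_or ac ad ae be ce !edge_neq //.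
by move=> [[|[|[|[|[|//]]]]] ?] [[|[|[|[|[|//]]]]] ?] //= _;
  rewrite ?ab ?bc ?cd ?de ?bd //; apply: negbTE.
Qed.

Lemma C5_freeP (G : sgraph) : ~ contains_induced G (cycle_graph 5) -> C5_free G.
Proof.
move=> H a b c d e ab bc cd de ea; apply: contra_notT H.
rewrite /cadj !negb_or => /and5P[/andP[ac ac'] /andP[ad ad'] /andP[bd bd']
  /andP[be be'] /andP[ce ce']].
apply: (@induced5 _ _ a b c d e).
  by rewrite /= !inE !negb_or ac ad bd be ce (eq_sym a e) !edge_neq.
by move=> [[|[|[|[|[|//]]]]] ?] [[|[|[|[|[|//]]]]] ?] //= _;
  rewrite ?ab ?bc ?cd ?de 1?(edge_sym a e) ?ea //; apply: negbTE.
Qed.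

(** * Vertex types relative to a longest induced path *)

(** Positions run from 1 to [k]; position 0 is kept free for the vertices that close the path into a
    hole. *)
Definition ipath (G : sgraph) (k : nat) (p : nat -> G) :=
  forall i j, 0 < i <= k -> 0 < j <= k ->
    (p i == p j) = (i == j) /\ cadj (p i) (p j) = (i <= j.+1) && (j <= i.+1).

(** Closed adjacency in the cycle of length [k + 1] on 0, ..., [k]; the last two disjuncts join 0 to
    [k]. *)
Definition cyc (k s t : nat) :=
  [|| (s <= t.+1) && (t <= s.+1), s == t + k | t == s + k].

Lemma cyc0 k i : 0 < i <= k -> cyc k 0 i = (i == 1) || (i == k).
Proof. rewrite /cyc; lia. Qed.

Lemma cycS k s i : 0 < s <= k -> 0 < i <= k ->
  cyc k s i = (s <= i.+1) && (i <= s.+1).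
Proof. rewrite /cyc; lia. Qed.

Section PathTypes.

Variables (G : sgraph) (k : nat).
Hypotheses (clawG : claw_free G) (bullG : bull_free G) (k5 : 5 <= k).
Hypothesis maxk : forall q : nat -> G, ~ ipath k.+1 q.

Lemma ipath_edge (p : nat -> G) i j : ipath k p -> 0 < i <= k -> 0 < j <= k ->
  (i == j.+1) || (j == i.+1) -> p i -- p j.
Proof. by move=> P ib jb ij; rewrite edge_cadj; have [-> ->] := P i j ib jb; lia. Qed.

Lemma ipath_ncadj (p : nat -> G) i j : ipath k p -> 0 < i <= k -> 0 < j <= k ->
  (i.+1 < j) || (j.+1 < i) -> cadj (p i) (p j) = false.
Proof. by move=> P ib jb ij; have [_ ->] := P i j ib jb; lia. Qed.

Lemma ipath_extendl (p : nat -> G) v : ipath k p ->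
  (forall i, 0 < i <= k -> v != p i) ->
  (forall i, 0 < i <= k -> cadj v (p i) = (i == 1)) -> False.
Proof.
move=> P vp va; apply: (@maxk (fun n => if n == 1 then v else p n.-1)).
move=> i j ib jb /=; case: (i =P 1) => i1; case: (j =P 1) => j1.
- by rewrite i1 j1 cadjxx !eqxx; split; lia.
- by rewrite va ?(negbTE (vp _ _)); try split; lia.
- by rewrite eq_sym cadjC va ?(negbTE (vp _ _)); try split; lia.
- by have [| |-> ->] := P i.-1 j.-1; try split; lia.
Qed.

Lemma ipath_extendr (p : nat -> G) v : ipath k p ->
  (forall i, 0 < i <= k -> v != p i) ->
  (forall i, 0 < i <= k -> cadj v (p i) = (i == k)) -> False.
Proof.
move=> P vp va; apply: (@maxk (fun n => if n == k.+1 then v else p n)).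
move=> i j ib jb /=; case: (i =P k.+1) => i1; case: (j =P k.+1) => j1.
- by rewrite i1 j1 cadjxx !eqxx; split; lia.
- by rewrite va ?(negbTE (vp _ _)); try split; lia.
- by rewrite eq_sym cadjC va ?(negbTE (vp _ _)); try split; lia.
- by have [| |-> ->] := P i j; try split; lia.
Qed.

(** The vertex sees on the path what position [t] of the cycle would see; type 0 sees exactly the
    two ends. *)
Definition has_type (p : nat -> G) v t :=
  t <= k /\ forall i, 0 < i <= k -> cadj v (p i) = cyc k t i.

(** Claws and bulls force a nonempty neighbourhood on the path to be the closed interval around one
    position, or the two ends; a single end would lengthen the path. *)
Lemma path_type (p : nat -> G) v : ipath k p ->
  (forall i, 0 < i <= k -> cadj v (p i) = false) \/ exists t, has_type p v t.
Proof.
move=> P.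
have [[j jb /eqP ->]|vp] := classic (exists2 j, 0 < j <= k & v == p j).
  right; exists j; split=> [|i ib]; first by lia.
  by have [_ ->] := P j i jb ib; rewrite /cyc; lia.
have {}vp i : 0 < i <= k -> v != p i.
  by move=> ib; apply/negP => E; apply: vp; exists i.
pose a i := cadj v (p i).
have ve i : 0 < i <= k -> a i -> v -- p i.
  by move=> ib ai; rewrite edge_cadj vp.
have E := ipath_edge P; have N := ipath_ncadj P.
(* [F1] uses a claw at [p i] and [F2] a claw at [v]. [F3] uses the bull on the triangle [v], [p i],
   [p i.+1] with both horns on the path next to it. In [F4], and its mirror image [F5], one horn is
   a distant neighbour [p j] attached to [v]. *)
have F1 i : 1 < i < k -> a i -> a i.-1 || a i.+1.
  move=> ib ai; have := @clawG (p i) (p i.-1) (p i.+1) v.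
  rewrite !E ?N 1?edge_sym ?ve; try lia.
  by rewrite ![cadj (p _) v]cadjC; apply.
have F2 i j l : 0 < i -> i.+1 < j -> j.+1 < l -> l <= k -> a i -> a j -> a l -> False.
  move=> i0 ij jl lk ai aj al; have := @clawG v (p i) (p j) (p l).
  by rewrite !ve ?N; try lia; move=> /(_ isT isT isT).
have F3 i : 1 < i -> i.+2 <= k -> a i -> a i.+1 -> a i.-1 || a i.+2.
  move=> i0 ik ai ai1; have := @bullG (p i.-1) (p i) v (p i.+1) (p i.+2).
  rewrite !E ?ve // 1?edge_sym ?ve ?N; try lia.
  by rewrite [cadj (p _) v]cadjC; apply.
have F4 i j : 0 < i -> i.+2 <= k -> 0 < j <= k -> (j.+1 < i) || (i.+3 < j) ->
    a i -> a i.+1 -> a j -> a i.+2.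
  move=> i0 ik jk ij ai ai1 aj; have := @bullG (p j) v (p i) (p i.+1) (p i.+2).
  rewrite !E ?ve // 1?edge_sym ?ve ?N; try lia.
  by move=> /(_ isT isT isT isT isT); rewrite orbF.
have F5 i j : 2 < i -> i <= k -> 0 < j <= k -> (j.+3 < i) || (i.+1 < j) ->
    a i -> a i.-1 -> a j -> a i.-2.
  move=> i0 ik jk ij ai ai1 aj; have := @bullG (p j) v (p i) (p i.-1) (p i.-2).
  rewrite !E ?ve // 1?edge_sym ?ve ?N; try lia.
  by move=> /(_ isT isT isT isT isT); rewrite orbF.
(* Let [j], [j.+1] be the first two consecutive neighbours: the type is 1 or 2 if [j] is 1, [k] if
   [j.+1] is [k], and [j.+1] otherwise. *)
case: (boolP [exists j : 'I_k, [&& 0 < j, a j & a j.+1]]) => [/existsP[j0 Hj]|NJ].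
  have ex : exists j, [&& 0 < j, j < k, a j & a j.+1].
    by exists j0; case/and3P: Hj => -> -> ->; rewrite ltn_ord.
  case: (ex_minnP ex) => j /and4P[j_gt0 jk aj aj1] jmin.
  have jm i : 0 < i -> i < j -> a i -> a i.+1 -> False.
    by move=> i0 ij ai ai1; have := jmin i; rewrite i0 ai ai1; lia.
  right; have [j1|j1] := leqP j 1.
    have jE : j = 1 by lia.
    subst j; have [a3|a3] := boolP (a 3).
      exists 2; split=> [|i ib]; first by lia.
      have a4 : ~~ a 4.
        apply/negP => a4; have a5 := F4 3 1 isT k5 ltac:(lia) isT a3 a4 aj.
        exact: (F2 1 3 5).
      have [i4|i4] := ltnP 4 i.
        have -> : cyc k 2 i = false by rewrite /cyc; lia.
        apply: negbTE; apply/negP => ai; apply: (F2 1 3 i) => //; lia.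
      have -> : cyc k 2 i = (i <= 3) by rewrite /cyc; lia.
      rewrite -/(a i); case: i ib i4 => [|[|[|[|[|]]]]] //= _ _.
      exact: negbTE.
    exists 1; split=> [|i ib]; first by lia.
    have a5 l : 4 < l -> l <= k -> a l = false.
      move=> l4 lk; apply: contraNF a3 => al; apply: (F4 1 l) => //; lia.
    have a4 : a 4 = false.
      by apply: contraNF a3 => /F1; rewrite /= (a5 5) // orbF; apply; lia.
    have [i4|i4] := ltnP 4 i.
      by rewrite -/(a i) a5 //; move: ib i4; rewrite /cyc; lia.
    have -> : cyc k 1 i = (i <= 2) by rewrite /cyc; lia.
    rewrite -/(a i); case: i ib i4 => [|[|[|[|[|]]]]] //= _ _.
    exact: negbTE.
  have ajm : a j.-1 = false.
    by apply/negP => aj'; apply: (jm j.-1) => //; rewrite ?prednK //; lia.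
  have [jk2|jk2] := ltnP j.+1 k.
    have aj2 : a j.+2 by have := F3 j j1 jk2 aj aj1; rewrite ajm.
    exists j.+1; split=> [|i ib]; first by lia.
    have iE : i.+1 < j \/ i = j.-1 \/ i = j \/ i = j.+1 \/ i = j.+2 \/ i = j.+3 \/ j.+3 < i.
      by lia.
    rewrite -/(a i); case: iE => [h|[h|[h|[h|[h|[h|h]]]]]].
    - have -> : cyc k j.+1 i = false by rewrite /cyc; lia.
      by apply: negbTE; apply/negP => ai; apply: (F2 i j j.+2) => //; lia.
    - by rewrite h ajm /cyc; lia.
    - by rewrite h aj /cyc; lia.
    - by rewrite h aj1 /cyc; lia.
    - by rewrite h aj2 /cyc; lia.
    - have -> : cyc k j.+1 i = false by rewrite /cyc; lia.
      by rewrite h; apply: contraFF ajm => ai; apply: (F5 j.+1 j.+3) => //; lia.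
    - have -> : cyc k j.+1 i = false by rewrite /cyc; lia.
      by apply: negbTE; apply/negP => ai; apply: (F2 j j.+2 i) => //; lia.
  have jE : j.+1 = k by lia.
  exists k; split=> [|i ib] //.
  have low l : 0 < l -> l.+3 < k -> a l = false.
    move=> l0 lk; apply/negP => al.
    by have := F5 k l; rewrite -jE /= ajm => H; suff: false by []; apply: H; lia.
  have k3 : a j.-2 = false.
    have E1 : j.-2.+1 = j.-1 by lia.
    have E2 : j.-2.-1.+1 = j.-2 by lia.
    apply/negP => aj3; have := F1 j.-2; rewrite E1 ajm orbF aj3 => H.
    by apply: (jm j.-2.-1); rewrite ?E2 ?H //; clear -j1 jE k5; lia.
  have iE : i.+3 < k \/ i = j.-2 \/ i = j.-1 \/ i = j \/ i = j.+1 by lia.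
  rewrite -/(a i); case: iE => [h|[h|[h|[h|h]]]].
  - by rewrite low /cyc; lia.
  - by rewrite h k3 /cyc; lia.
  - by rewrite h ajm /cyc; lia.
  - by rewrite h aj /cyc; lia.
  - by rewrite h aj1 /cyc; lia.
(* Without consecutive neighbours, [F1] excludes interior ones, so only the two ends remain. *)
have nocon j : 0 < j -> j < k -> a j -> a j.+1 = false.
  move=> j0 jk aj; apply: contraNF NJ => aj1; apply/existsP.
  by exists (Ordinal jk); rewrite /= j0 aj.
have inn j : 1 < j < k -> a j = false.
  move=> jb; apply/negP => aj; have := F1 j jb aj.
  rewrite nocon //; try lia; rewrite orbF => aj'.
  have := nocon j.-1; rewrite prednK; last lia; rewrite aj => H.
  by suff: true = false by []; apply: H; lia.
case a1: (a 1); case ak: (a k); last 1 first.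
- left=> i ib; rewrite -/(a i).
  by have [->|[->|/inn]] : i = 1 \/ i = k \/ 1 < i < k by lia.
- right; exists 0; split=> // i ib; rewrite -/(a i).
  have [->|[->|h]] : i = 1 \/ i = k \/ 1 < i < k by lia.
  + by rewrite a1.
  + by rewrite ak /cyc add0n eqxx !orbT.
  + by rewrite inn // /cyc; lia.
(* A vertex attached to one end alone prolongs the path, against its maximality. *)
- case: (ipath_extendl P vp) => i ib; rewrite -/(a i).
  have [->|[->|h]] : i = 1 \/ i = k \/ 1 < i < k by lia.
  + by rewrite a1.
  + by rewrite ak; lia.
  + by rewrite inn //; lia.
- case: (ipath_extendr P vp) => i ib; rewrite -/(a i).
  have [->|[->|h]] : i = 1 \/ i = k \/ 1 < i < k by lia.
  + by rewrite a1; lia.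
  + by rewrite ak; lia.
  + by rewrite inn //; lia.
Qed.
Lemma cycC s t : cyc k s t = cyc k t s.
Proof. by rewrite /cyc andbC [(_ == _) || _]orbC. Qed.

Lemma type_notin_path (p : nat -> G) v t i : ipath k p -> has_type p v t ->
  0 < t -> 0 < i <= k -> i != t -> v != p i.
Proof.
move=> P [tk T] t0 ib it; apply/negP => /eqP vE.
have H j : 0 < j <= k ->
    (i <= j.+1) && (j <= i.+1) = (t <= j.+1) && (j <= t.+1).
  move=> jb; rewrite -(@cycS k t) ?t0 // -T // vE.
  by have [_ ->] := P i j ib jb.
move: (H t) (H t.+1) (H t.-1) (H i.-1) (H i.+1).
clear - k5 t0 tk ib it; lia.
Qed.

(** A vertex of positive type [t] sees the path as [p t] does, so it may take its place. *)
Lemma ipath_replace (p : nat -> G) v t : ipath k p -> has_type p v t ->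
  0 < t -> ipath k (fun n => if n == t then v else p n).
Proof.
move=> P T t0 i j ib jb /=; have [tk Tv] := T.
case: (i =P t) => it; case: (j =P t) => jt.
- by rewrite it jt cadjxx !eqxx; split; lia.
- rewrite Tv // (negbTE (type_notin_path P T _ jb _)) //; last by lia.
  by rewrite /cyc; split; lia.
- rewrite cadjC Tv // eq_sym (negbTE (type_notin_path P T _ ib _)) //; last by lia.
  by rewrite /cyc; split; lia.
- exact: P.
Qed.

(** Every type keeps a neighbour on the path away from position [t], so replacing [p t] never makes
    a vertex lose sight of the path. *)
Lemma type_has_nbr s t : s <= k ->
  exists i, [/\ 0 < i <= k, i != t & cyc k s i].
Proof.
move=> sk; case: s sk => [|s] sk.
  have [->|t1] := eqVneq t 1; [exists k | exists 1]; rewrite /cyc; split; lia.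
have [->|t1] := eqVneq t s.+1; last by exists s.+1; rewrite /cyc; split; lia.
by have [s1|s1] := ltnP s.+1 k; [exists s.+2|exists s]; rewrite /cyc; split; lia.
Qed.

(* A vertex of type 1 or 2 (resp. k-1 or k) looks alike from the path with
   position 3 (resp. k-2) removed. *)
Definition ambiguous (s t : nat) :=
  [|| (0 < s <= 2) && (t == 3) | (k <= s.+1) && (t.+2 == k)].

Lemma nbrs_neq_ends s t : 0 < s <= k -> 0 < t <= k ->
  ~ (forall i, 0 < i <= k -> i != t ->
       (s <= i.+1) && (i <= s.+1) = (i == 1) || (i == k)).
Proof.
move=> sk tk H; have [t1|t1] := eqVneq t 1.
  have Hk := H k ltac:(lia) ltac:(lia).
  by have Hk1 := H k.-1 ltac:(lia) ltac:(lia); clear H; lia.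
have H1 := H 1 ltac:(lia) ltac:(lia); have [tk'|tk'] := eqVneq t k.
  by have H2 := H 2 ltac:(lia) ltac:(lia); clear H; lia.
by have Hk := H k ltac:(lia) ltac:(lia); clear H; lia.
Qed.

(** Here [t'] stands for the type of a vertex after position [t] was replaced. Outside the ambiguous
    cases the unchanged positions determine the type, so [t'] equals [s]. *)
Lemma retype s t t' : s <= k -> 0 < t <= k -> t' <= k -> ~~ ambiguous s t ->
  (forall i, 0 < i <= k -> i != t -> cyc k t' i = cyc k s i) ->
  cyc k t' t = cyc k s t.
Proof.
rewrite /ambiguous => sk tk tk' amb H.
have [s0|s0] := posnP s; have [t0|t0] := posnP t'.
- by rewrite s0 t0.
- have {}H i : 0 < i <= k -> i != t ->
      (t' <= i.+1) && (i <= t'.+1) = (i == 1) || (i == k).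
    by move=> ib it; rewrite -cyc0 // -(@cycS k t') ?t0 // H // s0.
  by case: (@nbrs_neq_ends t' t) => //; rewrite t0.
- have {}H i : 0 < i <= k -> i != t ->
      (s <= i.+1) && (i <= s.+1) = (i == 1) || (i == k).
    by move=> ib it; rewrite -cyc0 // -(@cycS k s) ?s0 // -H // t0.
  by case: (@nbrs_neq_ends s t) => //; rewrite s0.
have {}H i : 0 < i <= k -> i != t ->
    (t' <= i.+1) && (i <= t'.+1) = (s <= i.+1) && (i <= s.+1).
  by move=> ib it; rewrite -!(@cycS k) ?t0 ?s0 // H.
have [at3 atk] : (s <= 2 -> t != 3) /\ (k <= s.+1 -> t.+2 != k).
  by move: amb; rewrite s0; clear; lia.
rewrite !cycS ?s0 ?t0 //; clear amb.
case: (ltngtP s t') => [st|ts|->//]; exfalso.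
  have [s1|s1] := leqP s 1.
    have t3 : t != 3 by apply: at3; lia.
    have H3 := H 3 ltac:(lia) ltac:(lia).
    have [t1|t1] := eqVneq t 1.
      by have H2 := H 2 ltac:(lia) ltac:(lia); clear H at3 atk; lia.
    by have H1 := H 1 ltac:(lia) ltac:(lia); clear H at3 atk; lia.
  have [ts|ts] := eqVneq t s.-1.
    have Hs := H s ltac:(lia) ltac:(lia).
    have sk2 : s.+2 <= k by move: atk; clear - ts s1 st tk'; lia.
    by have Hs2 := H s.+2 ltac:(lia) ltac:(lia); clear H at3 atk; lia.
  by have Hs1 := H s.-1 ltac:(lia) ltac:(lia); clear H at3 atk; lia.
have [s1|s1] := ltnP s k; last first.
  have tk2 : t.+2 != k by apply: atk; lia.
  have Hk2 := H k.-2 ltac:(lia) ltac:(lia).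
  have [tk1|tk1] := eqVneq t k.
    by have Hk1 := H k.-1 ltac:(lia) ltac:(lia); clear H at3 atk; lia.
  by have Hk := H k ltac:(lia) ltac:(lia); clear H at3 atk; lia.
have [ts1|ts1] := eqVneq t s.+1.
  have Hs := H s ltac:(lia) ltac:(lia).
  have s2 : 2 < s by move: at3; clear - ts1 ts t0; lia.
  by have Hs2 := H s.-2 ltac:(lia) ltac:(lia); clear H at3 atk; lia.
by have Hs1 := H s.+1 ltac:(lia) ltac:(lia); clear H at3 atk; lia.
Qed.

Lemma cyc_inj s t : s <= k -> t <= k ->
  (forall i, 0 < i <= k -> cyc k s i = cyc k t i) -> s = t.
Proof.
move=> sk tk H.
have [s0|s0] := posnP s; have [t0|t0] := posnP t.
- by rewrite s0 t0.
- have {}H i : 0 < i <= k ->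
      (i == 1) || (i == k) = (t <= i.+1) && (i <= t.+1).
    by move=> ib; rewrite -cyc0 // -(@cycS k t) ?t0 // -H // s0.
  by move: (H 1) (H k); clear H; lia.
- have {}H i : 0 < i <= k ->
      (i == 1) || (i == k) = (s <= i.+1) && (i <= s.+1).
    by move=> ib; rewrite -cyc0 // -(@cycS k s) ?s0 // H // t0.
  by move: (H 1) (H k); clear H; lia.
have {}H i : 0 < i <= k -> (s <= i.+1) && (i <= s.+1) = (t <= i.+1) && (i <= t.+1).
  by move=> ib; rewrite -!(@cycS k) ?t0 ?s0 // H.
by move: (H s.-1) (H s) (H s.+1) (H t.-1) (H t) (H t.+1); clear H; lia.
Qed.

(** With [v] put at position [t], the type of [u] on the new path, read at [t], decides whether [u]
    and [v] are adjacent; [retype] compares it with the old type. *)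
Lemma cadj_type_replace (p : nat -> G) u v s t : ipath k p ->
  has_type p u s -> has_type p v t -> 0 < t -> ~~ ambiguous s t ->
  cadj u v = cyc k s t.
Proof.
move=> P [sk Tu] T t0 amb; have [tk Tv] := T.
have Q := ipath_replace P T t0.
case: (path_type u Q) => [no|[t' [tk' Tu']]].
  have [i [ib it si]] := type_has_nbr t sk.
  by have := no i ib; rewrite (negbTE it) Tu // si.
have -> : cadj u v = cyc k t' t by rewrite -Tu' ?eqxx ?t0.
apply: retype; rewrite ?t0 // => i ib it.
by rewrite -Tu' // (negbTE it) Tu.
Qed.

(** As [5 <= k], a pair and its swap are never both ambiguous, so replacement works from one side or
    the other. For two vertices of type 0, the claw at [p 1] with third leaf [p 2] forces
    adjacency. *)
Lemma cadj_type (p : nat -> G) u v s t : ipath k p ->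
  has_type p u s -> has_type p v t -> cadj u v = cyc k s t.
Proof.
move=> P Tu Tv; have [sk Eu] := Tu; have [tk Ev] := Tv.
have [t0|t0] := posnP t; last first.
  have [amb|amb] := boolP (ambiguous s t); last first.
    exact: cadj_type_replace P Tu Tv t0 amb.
  rewrite cadjC cycC; apply: (cadj_type_replace P Tv Tu);
    by move: amb; rewrite /ambiguous; lia.
have [s0|s0] := posnP s; last first.
  rewrite cadjC cycC; apply: (cadj_type_replace P Tv Tu) => //.
  by rewrite t0 /ambiguous; lia.
have E2 : 0 < 2 <= k by lia.
have off w : has_type p w 0 -> p 1 -- w.
  move=> [_ Tw]; rewrite edge_cadj cadjC Tw; last by lia.
  rewrite cyc0 ?eqxx ?andbT; last by lia.
  apply/eqP => E1; have := Tw 2 E2; rewrite -E1 cyc0 //.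
  by have [_ ->] := P 1 2 ltac:(lia) E2; lia.
have -> : cyc k s t by rewrite s0 t0.
subst s t; have := @clawG (p 1) u v (p 2).
rewrite (off u) // (off v) // (ipath_edge P) //; last by lia.
by rewrite Eu // Ev // !cyc0 //; do 3!move=> /(_ isT); case: cadj => //=; lia.
Qed.

(** Having a type spreads along edges. Suppose [y] is adjacent to a typed [x] but sees nothing of
    the path. If [x] has type 0, there is a claw at [x]; otherwise [x] replaces a path vertex, and
    the type of [y] on the new path yields a neighbour on the old one. *)
Lemma all_typed (p : nat -> G) : connected G -> ipath k p ->
  forall v, exists t, has_type p v t.
Proof.
move=> conG P v.
have base : exists t, has_type p (p 1) t.
  exists 1; split=> [|i ib]; first by lia.
  by have [_ ->] := P 1 i ltac:(lia) ib; rewrite cycS; lia.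
have step x y : (exists t, has_type p x t) -> x -- y -> exists t, has_type p y t.
  move=> [t T] xy; case: (path_type y P) => // no; exfalso.
  have [tk Tx] := T; have [t0|t0] := posnP t.
    subst t; have yp i : 0 < i <= k -> y != p i.
      by move=> ib; apply: contraTneq isT => E; have := no i ib; rewrite E cadjxx.
    have xp i : 0 < i <= k -> x != p i.
      move=> ib; apply: contraTneq isT => E.
      by have := no i ib; rewrite -E cadjC /cadj xy orbT.
    have xe i : 0 < i <= k -> (i == 1) || (i == k) -> x -- p i.
      by move=> ib ik; rewrite edge_cadj xp // Tx // cyc0.
    have := @clawG x y (p 1) (p k); rewrite xy !xe ?eqxx ?orbT; try lia.
    move=> /(_ isT isT isT); rewrite !no ?(ipath_ncadj P); lia.
  have Q := ipath_replace P T t0.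
  case: (path_type y Q) => [|[t' [tk' Ty]]].
    move=> /(_ t); rewrite eqxx cadjC /cadj xy orbT t0 tk => H.
    by have := H isT.
  have [i [ib it ci]] := type_has_nbr t tk'.
  by have := Ty i ib; rewrite (negbTE it) ci no.
have /connectP [q] := conG (p 1) v.
elim: q (p 1) base => [x Tx _ ->//|y q IH x Tx /= /andP[xy yq] vE].
by apply: IH yq vE; apply: step xy.
Qed.

(** Types become class indices. The path itself meets every positive class; class 0, of the closing
    vertices, may be empty. *)
Lemma path_expansion (p : nat -> G) : connected G -> ipath k p ->
  exists phi : G -> 'I_k.+1,
    (forall u v, cadj u v = cyc k (phi u) (phi v)) /\
    (forall i : 'I_k.+1, 0 < i -> exists u, phi u = i).
Proof.
move=> conG P; have ty := all_typed conG P.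
pose good v (t : 'I_k.+1) :=
  [forall i : 'I_k.+1, (0 < i) ==> (cadj v (p i) == cyc k t i)].
have goodP v t : good v t -> has_type p v t.
  move=> /forallP H; split=> [|i ib]; first by rewrite -ltnS ltn_ord.
  have ik : i < k.+1 by lia.
  by have := H (Ordinal ik); case/andP: ib => -> _ /= /eqP.
have exg v : [exists t, good v t].
  have [t [tk T]] := ty v; have tk' : t < k.+1 by lia.
  apply/existsP; exists (Ordinal tk'); apply/forallP => i; apply/implyP => i0.
  by rewrite T // i0 -ltnS ltn_ord.
pose phi v := xchoose (existsP (exg v)).
have phiP v : has_type p v (phi v) by apply: goodP; exact: (xchooseP (existsP (exg v))).
exists phi; split=> [u v|i i0]; first exact: cadj_type P (phiP u) (phiP v).
exists (p i); apply: val_inj; have [tk T] := phiP (p i).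
have ik : i <= k by rewrite -ltnS ltn_ord.
apply: cyc_inj => // j jb; rewrite -T //; have [_ ->] := P i j ltac:(lia) jb.
by rewrite cycS // i0.
Qed.

End PathTypes.

(** * Three pairwise nonadjacent vertices *)

Lemma ncadj_neq (G : sgraph) (x y : G) : ~~ cadj x y -> x != y.
Proof. by rewrite negb_or => /andP[]. Qed.

Lemma ipath5 (G : sgraph) (a b c d e : G) :
  a -- b -> b -- c -> c -- d -> d -- e ->
  ~~ cadj a c -> ~~ cadj a d -> ~~ cadj a e -> ~~ cadj b d -> ~~ cadj b e ->
  ~~ cadj c e -> ipath 5 (fun n => nth a [:: a; b; c; d; e] n.-1).
Proof.
move=> ab bc cd de ac ad ae bd be ce.
have F := (negbTE (edge_neq ab), negbTE (edge_neq bc), negbTE (edge_neq cd),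
  negbTE (edge_neq de), negbTE (ncadj_neq ac), negbTE (ncadj_neq ad),
  negbTE (ncadj_neq ae), negbTE (ncadj_neq bd), negbTE (ncadj_neq be),
  negbTE (ncadj_neq ce)).
have E (x y : G) : x -- y -> cadj x y by rewrite /cadj => ->; rewrite orbT.
have F' := (E _ _ ab, E _ _ bc, E _ _ cd, E _ _ de, negbTE ac, negbTE ad,
  negbTE ae, negbTE bd, negbTE be, negbTE ce).
move=> [|[|[|[|[|[|i]]]]]] [|[|[|[|[|[|j]]]]]] //= _ _;
  rewrite ?eqxx ?cadjxx ?F ?F' //; by rewrite eq_sym cadjC ?F ?F'.
Qed.

Lemma ipath_leq_card (G : sgraph) k (p : nat -> G) : ipath k p -> k <= #|G|.
Proof.
move=> P; rewrite -[k]card_ord.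
apply: (@leq_card _ _ (fun i : 'I_k => p i.+1)) => i j /eqP.
have [i1 j1] := (ltn_ord i, ltn_ord j).
have [-> _] := P i.+1 j.+1 i1 j1; rewrite eqSS => /eqP; exact: val_inj.
Qed.

Lemma max_ipath (G : sgraph) k (p : nat -> G) : ipath k p ->
  exists k' (q : nat -> G),
    [/\ k <= k', ipath k' q & forall r : nat -> G, ~ ipath k'.+1 r].
Proof.
have [n] := ubnP (#|G| - k); elim: n k p => // n IH k p le_n P.
have [[q Q]|no] := classic (exists q : nat -> G, ipath k.+1 q); last first.
  by exists k, p; split=> // r R; apply: no; exists r.
have [|k' [r [le_k R maxr]]] := IH k.+1 q _ Q.
  by have := ipath_leq_card Q; lia.
by exists k', r; split=> //; apply: ltnW.
Qed.

Section IndependentTriple.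

Variable G : sgraph.
Hypotheses (clawG : claw_free G) (bullG : bull_free G) (conG : connected G).
Hypothesis noP5 : forall p : nat -> G, ~ ipath 5 p.

Lemma connected_step (D : pred G) x0 : D x0 ->
  (forall x y, D x -> x -- y -> D y) -> forall y, D y.
Proof.
move=> Dx step y; have /connectP [q] := conG x0 y.
elim: q x0 Dx => [x Dx _ ->//|z q IH x Dx /= /andP[xz zq] yE].
by apply: IH zq yE; apply: step xz.
Qed.

(** The set dominated by [a], [u], [b] is closed under adjacency. If [x] is in it and its neighbour
    [c] is not, then the neighbours of [x] among the three give a claw at [x] (both ends), a bull
    ([u] and one end), a claw at [u] ([u] alone) or an induced path on five vertices (one end
    alone). *)
Lemma P3_dominates (a u b w : G) : a -- u -> u -- b -> ~~ cadj a b ->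
  [|| cadj w a, cadj w u | cadj w b].
Proof.
move=> au ub ab; pose D w := [|| cadj w a, cadj w u | cadj w b].
apply: (@connected_step D a _ _ w); first by rewrite /D cadjxx.
move=> x c Dx xc; apply/negPn/negP => /norP[ca /norP[cu cb]].
have E y : ~~ cadj c y -> x -- y = cadj x y.
  move=> cy; rewrite edge_cadj; case: eqP => // xy.
  by move: cy; rewrite -xy cadjC /cadj xc orbT.
have ba : ~~ cadj b a by rewrite cadjC.
have [ua bu cx] : [/\ u -- a, b -- u & c -- x] by split; rewrite edge_sym.
move: Dx; rewrite /D; case xa: (cadj x a); case xu: (cadj x u);
  case xb: (cadj x b) => // _.
- have := @clawG x a b c; rewrite (E a) // (E b) // xa xb xc (negbTE ab).
  by rewrite !(cadjC _ c) (negbTE ca) (negbTE cb); auto.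
- have := @bullG c x a u b; rewrite (E a) // (E u) // xa xu; move=> /(_ cx isT au ub isT).
  by rewrite (negbTE ca) (negbTE cu) (negbTE cb) xb (negbTE ab).
- have := @clawG x a b c; rewrite (E a) // (E b) // xa xb xc (negbTE ab).
  by rewrite !(cadjC _ c) (negbTE ca) (negbTE cb); auto.
- apply: (noP5 (ipath5 cx _ au ub ca cu cb _ _ ab)); by rewrite ?E ?xa ?xu ?xb.
- have := @bullG c x b u a; rewrite (E b) // (E u) // xb xu; move=> /(_ cx isT bu ua isT).
  by rewrite (negbTE ca) (negbTE cu) (negbTE cb) xa (negbTE ba).
- have := @clawG u a b x; rewrite ua ub edge_sym E // xu (negbTE ab) ![cadj _ x]cadjC
    xa xb.
  by move=> /(_ isT isT isT).
- apply: (noP5 (ipath5 cx _ bu ua cb cu ca _ _ ba)); by rewrite ?E ?xa ?xu ?xb.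
Qed.

(** An induced path [a], [x], [y] dominates the other two vertices only through [y], which leaves a
    claw at [y] with leaves [x], [b], [c]. *)
Lemma P5free_independent_triple (a b c : G) : [|| cadj a b, cadj a c | cadj b c].
Proof.
apply/negPn/negP => /norP[ab /norP[ac bc]].
have [x [y [ax xy ay]]] : exists x y, [/\ cadj a x, x -- y & ~~ cadj a y].
  apply: NNPP => H; move: ab; rewrite (_ : cadj a b) //.
  apply: (@connected_step (cadj a) a) => [|x y ax xy]; first exact: cadjxx.
  by apply/negPn/negP => ay; apply: H; exists x, y.
have {}ax : a -- x.
  rewrite edge_cadj ax andbT; apply: contraNneq ay => ->; by rewrite /cadj xy orbT.
have xa : x -- a by rewrite edge_sym.
(* If [z] were adjacent to [x], the path [a], [x], [z] would dominate [z'] through [x], giving a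
   claw at [x]. *)
have far z z' : ~~ cadj a z -> ~~ cadj a z' -> ~~ cadj z z' -> ~~ cadj z x.
  move=> az az' zz'; apply/negP => zx.
  have {}zx : x -- z.
    by rewrite edge_sym edge_cadj zx andbT; apply: contraNneq az => ->; rewrite /cadj ax orbT.
  have := P3_dominates z' ax zx az.
  rewrite ![cadj z' _]cadjC (negbTE az') (negbTE zz') orbF /= => xz'.
  have {}xz' : x -- z'.
    by rewrite edge_cadj xz' andbT; apply: contraNneq az' => <-; rewrite /cadj ax orbT.
  by have := clawG xa zx xz'; rewrite (negbTE az) (negbTE az') (negbTE zz').
have bx := far b c ab ac bc.
have cx : ~~ cadj c x by apply: (far c b) => //; rewrite cadjC.
have near z : ~~ cadj a z -> ~~ cadj z x -> cadj y z.
  move=> az zx; have := P3_dominates z ax xy ay.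
  by rewrite cadjC (negbTE az) (negbTE zx) cadjC.
have yb := near b ab bx; have yc := near c ac cx.
have yx : y -- x by rewrite edge_sym.
have yb' : y -- b.
  rewrite edge_cadj yb andbT; apply: contraNneq bc => <-; exact: yc.
have yc' : y -- c.
  by rewrite edge_cadj yc andbT; apply: contraNneq bc => <-; rewrite cadjC.
by have := clawG yx yb' yc'; rewrite ![cadj x _]cadjC (negbTE bx) (negbTE cx) (negbTE bc).
Qed.

End IndependentTriple.

Lemma triple_expansion (G : sgraph) (a b c : G) :
  claw_free G -> bull_free G -> connected G ->
  ~~ [|| cadj a b, cadj a c | cadj b c] ->
  exists k (phi : G -> 'I_k.+1), [/\ 5 <= k,
    forall u v, cadj u v = cyc k (phi u) (phi v) &
    forall i : 'I_k.+1, 0 < i -> exists u, phi u = i].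
Proof.
move=> clawG bullG conG abc.
have [p P] : exists p : nat -> G, ipath 5 p.
  apply: NNPP => no; move/negP: abc; apply.
  by apply: P5free_independent_triple => // p P; apply: no; exists p.
have [k [q [k5 Q maxk]]] := max_ipath P.
by have [phi [E S]] := path_expansion clawG bullG k5 maxk conG Q; exists k, phi.
Qed.

(** * Colouring cyclic clique expansions *)

Lemma clique_contains (G : sgraph) (A : {set G}) r :
  r <= #|A| -> {in A &, forall x y, cadj x y} ->
  contains G (complete_graph r).
Proof.
move=> rA cA; exists (fun i : 'I_r => enum_val (widen_ord rA i)).
have inj : injective (fun i : 'I_r => enum_val (widen_ord rA i)).
  by move=> i j /enum_val_inj /(congr1 val) /= ij; apply: val_inj.
split=> // i j /andP[ij _].
by rewrite edge_cadj cA ?enum_valP // (inj_eq inj) ij.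
Qed.

(** A discrete intermediate value property: the last term takes [e], the least admissible value that
    the others can complete to [T]. *)
Lemma sum_interval m (lo hi : nat -> nat) T :
  (forall i, i < m -> lo i <= hi i) ->
  \sum_(i < m) lo i <= T <= \sum_(i < m) hi i ->
  exists d : nat -> nat,
    (forall i, i < m -> lo i <= d i <= hi i) /\ \sum_(i < m) d i = T.
Proof.
elim: m T => [|m IH] T le_lh.
  by rewrite !big_ord0 => T0; exists lo; rewrite big_ord0; split=> //; lia.
have le_sum : \sum_(i < m) lo i <= \sum_(i < m) hi i.
  by apply: leq_sum => i _; apply: le_lh; apply: ltnW; rewrite ltnS.
rewrite !big_ord_recr /=; have := le_lh m (ltnSn m).
move: le_sum; set SL := \sum_(i < m) lo i; set SH := \sum_(i < m) hi i.
move=> le_sum lhm Tb; pose e := maxn (lo m) (T - SH).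
have [||d [db dT]] := IH (T - e).
- by move=> i im; apply: le_lh; apply: ltnW.
- by rewrite -/SL -/SH /e; clearbody SL SH; lia.
exists (fun i => if i < m then d i else e); split=> [i|].
  rewrite ltnS leq_eqVlt => /orP[/eqP->|im]; last by rewrite im db.
  by rewrite ltnn /e; clearbody SL SH; lia.
rewrite big_ord_recr /= ltnn.
under eq_bigr => i _ do rewrite ltn_ord.
by rewrite dT /e; clearbody SL SH; lia.
Qed.

Lemma mod5_neq a b : a < b < a + 5 -> a != b %[mod 5].
Proof. lia. Qed.

Definition class_size (G : sgraph) m (phi : G -> 'I_m) (i : nat) :=
  #|[set u | phi u == i :> nat]|.

Section CyclicExpansion.

Variables (G : sgraph) (m : nat) (phi : G -> 'I_m).
Hypotheses (m5 : 5 < m).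
Hypothesis phiE : forall u v, cadj u v = cyc m.-1 (phi u) (phi v).

Local Notation N := (class_size phi).

Lemma class_pair_clique i j : cyc m.-1 i j -> i < m -> j < m -> i != j ->
  ~ contains G (complete_graph 6) -> N i + N j <= 5.
Proof.
move=> cij im jm ij noK6; rewrite leqNgt; apply/negP => lt5; apply: noK6.
pose A := [set u | phi u == i :> nat] :|: [set u | phi u == j :> nat].
apply: (@clique_contains _ A).
  rewrite cardsU [X in _ - X](_ : _ = 0) ?subn0 //; apply/eqP.
  rewrite cards_eq0 -subset0; apply/subsetP => u; rewrite !inE => /andP[/eqP -> ij'].
  by rewrite ij' in ij.
move=> u v; rewrite phiE !inE => /orP[] /eqP -> /orP[] /eqP -> //.
- by rewrite /cyc leqnSn.
- by rewrite cycC.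
- by rewrite /cyc leqnSn.
Qed.

(** The offset of the colour of [u] within the arc of its class. *)
Let rank u := index u (enum [set v | phi v == phi u]).

Lemma rank_ltn u : rank u < N (phi u).
Proof.
have -> : N (phi u) = size (enum [set v | phi v == phi u]).
  by rewrite -cardE; apply: eq_card => v; rewrite !inE.
by rewrite index_mem mem_enum inE.
Qed.

Lemma rank_inj u v : phi u = phi v -> rank u = rank v -> u = v.
Proof.
move=> E; rewrite /rank E => /index_inj; apply; by rewrite ?mem_enum ?inE ?E.
Qed.

Let next i := if i.+1 == m then 0 else i.+1.

Lemma sum_next (F : nat -> nat) : \sum_(i < m) F (next i) = \sum_(i < m) F i.
Proof.
rewrite /next; clear - m5; case: m m5 => // n _.
rewrite big_ord_recr /= eqxx big_ord_recl /= addnC; congr (_ + _).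
by apply: eq_bigr => i _; rewrite /bump /= eqSS (ltn_eqF (ltn_ord i)).
Qed.

(* Class i receives the N i consecutive colours modulo 5 starting at
   \sum_(j < i) d j: consecutive classes get disjoint arcs when
   N i <= d i <= 5 - N (i + 1), and the arcs close up when the d i sum to a
   multiple of 5. *)
Lemma colorable_sum q :
  (forall i, i < m -> N i + N (next i) <= 5) ->
  \sum_(i < m) N i <= 5 * q -> 2 * q <= m -> colorable 5 G.
Proof.
move=> pair le_q q_m.
have sumhi : \sum_(i < m) (5 - N (next i)) + \sum_(i < m) N i = 5 * m.
  rewrite -(sum_next N) -big_split /= mulnC -[X in X * 5]card_ord -sum_nat_const.
  by apply: eq_bigr => i _; have := pair i (ltn_ord i); lia.
(* The target fits: the upper bounds add up to [5 * m] minus the order of [G], which is at least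
   [10 * q - 5 * q]. *)
have [||d [db dsum]] := @sum_interval m N (fun i => 5 - N (next i)) (5 * q).
- by move=> i im; have := pair i im; lia.
- by move: sumhi le_q; lia.
pose x i := \sum_(j < i) d j.
have xS i : x i.+1 = x i + d i by rewrite /x big_ord_recr.
have x5 u : (x (phi u) + rank u) %% 5 < 5 by rewrite ltn_mod.
exists (fun u => Ordinal (x5 u)) => u v.
wlog uv : u v / phi u <= phi v.
  move=> W; case: (leqP (phi u) (phi v)) => [|/ltnW] vu uv; first exact: W.
  by rewrite eq_sym; apply: W => //; rewrite edge_sym.
rewrite edge_cadj phiE -val_eqE /= => /andP[u_v].
have [ru rv] := (rank_ltn u, rank_ltn v).
have [pu pv] := (pair _ (ltn_ord (phi u)), pair _ (ltn_ord (phi v))).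
have [du dv] := (db _ (ltn_ord (phi u)), db _ (ltn_ord (phi v))).
have [E|ne] := eqVneq (phi u) (phi v).
  have : rank u != rank v by apply: contraNneq u_v => /(rank_inj E) ->.
  by move: pu pv ru rv; rewrite E; lia.
have {ne}lt_uv : phi u < phi v by rewrite ltn_neqAle ne.
have vm := ltn_ord (phi v).
move=> c; have : phi v = (phi u).+1 :> nat \/ (phi u = 0 :> nat) /\ (phi v).+1 = m.
  by move: c; rewrite /cyc; lia.
move=> [E|[E0 Em]].
  have nE : next (phi u) = phi v by rewrite /next -E ltn_eqF.
  by rewrite nE in pu du; rewrite E xS; lia.
have nE : next (phi v) = phi u by rewrite /next Em eqxx E0.
rewrite nE in pv dv; have x0 : x (phi u) = 0 by rewrite E0 /x big_ord0.
have xv := xS (phi v); rewrite Em (_ : x m = 5 * q) // in xv.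
have -> : x (phi u) + rank u = rank u %[mod 5] by rewrite x0.
(* Adding [5 * q], the total of the [d i], moves the start of class 0 to the end of the slot of
   class [m.-1], so the two classes compare as consecutive ones. *)
rewrite -(modnMDl q) eq_sym mulnC xv -addnA eqn_modDl.
by apply: mod5_neq; lia.
Qed.

Lemma pair_sum a q : (forall i, i.+1 < m -> N i + N i.+1 <= 5) ->
  a + 2 * q <= m -> \sum_(i < 2 * q) N (a + i) <= 5 * q.
Proof.
move=> pair; elim: q => [|q IH] aq; first by rewrite big_ord0.
have -> : 2 * q.+1 = (2 * q).+2 by lia.
have {}IH := IH ltac:(lia); have {}pair := pair (a + 2 * q) ltac:(lia).
rewrite !big_ord_recr /= !addnS -addnA mulnS addnC.
exact: leq_add.
Qed.

Lemma cyclic_expansion_iso :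
  isomorphic G (clique_expansion (fun i : 'I_m => #|[set u | phi u == i]|)).
Proof.
pose k (i : 'I_m) := #|[set u | phi u == i]|.
pose f (u : {i : 'I_m & 'I_(k i)}) : G := enum_val (tagged u).
have phif u : phi (f u) = tag u by have := enum_valP (tagged u); rewrite inE => /eqP.
have f_inj : injective f.
  move=> u v E; have := phif u; rewrite E phif; move: E; rewrite /f.
  case: u v => [i a] [j b] /= E ij; move: a b E; rewrite ij => a b E.
  by rewrite (enum_val_inj E).
have cl x : x \in [set u | phi u == phi x] by rewrite inE.
pose g x : {i : 'I_m & 'I_(k i)} := Tagged (fun i => 'I_(k i)) (enum_rank_in (cl x) x).
have gK : cancel g f by move=> x; rewrite /f /= enum_rankK_in.
exists f; split; first by exists g => // u; apply: f_inj; rewrite gK.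
move=> u v; rewrite edge_cadj phiE !phif (inj_eq f_inj) /=; congr (_ && _).
case: u v => [i a] [j b] /=; rewrite [j == i]eq_sym -[in RHS]val_eqE.
have SE (l : 'I_m) : l.+1 %% m = next l.
  rewrite /next; case: eqP => [->|lm]; first by rewrite modnn.
  by rewrite modn_small //; have := ltn_ord l; lia.
rewrite -!val_eqE /= !SE /next /cyc.
move: (ltn_ord i) (ltn_ord j); clear - m5.
by case: (i.+1 =P m) => ?; case: (j.+1 =P m) => ?; lia.
Qed.

End CyclicExpansion.

(** Consecutive classes pair up to at most 5 vertices. This bounds the order by [5 * q] for [2 * q]
    classes; for [2 * q + 1] classes and a larger order, class 0 is nonempty, as otherwise the
    remaining classes would pair up. *)
Lemma expansion_alternative (G : sgraph) k (phi : G -> 'I_k.+1) :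
  5 <= k -> (forall u v, cadj u v = cyc k (phi u) (phi v)) ->
  (forall i : 'I_k.+1, 0 < i -> exists u, phi u = i) ->
  ~ contains G (complete_graph 6) ->
  (exists (n : nat) (k : 'I_(2 * n + 1) -> nat),
    [/\ 1 <= n, forall i, 0 < k i,
        isomorphic G (clique_expansion k) & 5 * n < \sum_i k i]) \/
  colorable 5 G.
Proof.
(* The number of classes becomes a variable, so that [2 * q + 1] can be substituted for it. *)
move mE : k.+1 phi => m phi k5 phiE surj noK6.
have {}phiE u v : cadj u v = cyc m.-1 (phi u) (phi v) 
  by rewrite phiE (_ : m.-1 = k) -?mE.
have m5 : 5 < m by rewrite -mE.
pose N := class_size phi.
have pair i : i.+1 < m -> N i + N i.+1 <= 5.
  move=> im; apply: (class_pair_clique phiE _ _ im _ noK6); rewrite /cyc; lia.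
have pair0 : N m.-1 + N 0 <= 5.
  apply: (class_pair_clique phiE _ _ _ _ noK6); rewrite /cyc; lia.
have col q : \sum_(i < m) N i <= 5 * q -> 2 * q <= m -> colorable 5 G.
  move=> Sq qm; apply: (colorable_sum m5 phiE _ Sq qm) => i im.
  case: eqP => [im'|im']; last by apply: pair; lia.
  by rewrite (_ : i = m.-1) //; lia.
have [q [mq|mq]] : exists q, m = 2 * q \/ m = 2 * q + 1 by exists m./2; lia.
  right; apply: (col q); last by lia.
  by rewrite [in X in X <= _]mq; apply: (pair_sum m5 (a := 0) pair); lia.
have [small|large] := leqP (\sum_(i < m) N i) (5 * q).
  by right; apply: (col q) => //; lia.
have N0 : 0 < N 0.
  rewrite lt0n; apply: contraTneq large => N0; rewrite -leqNgt.
  have := pair_sum m5 (a := 1) (q := q) pair; rewrite -/N [in X in _ -> X]mq.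
  move=> /(_ ltac:(lia)).
  by rewrite addn1 big_ord_recl N0 add0n.
left; clear mE pair pair0 col; subst m.
exists q, (fun i => #|[set u | phi u == i]|); split=> [|i||].
- lia.
- have [i0|i0] := posnP i.
    rewrite (_ : #|_| = N 0) //; apply: eq_card => u.
    by rewrite !inE -(inj_eq val_inj) /= i0.
  by have [u <-] := surj i i0; apply/card_gt0P; exists u; rewrite inE.
- exact: (cyclic_expansion_iso m5 phiE).
- exact: large.
Qed.

(** * Complements of bipartite graphs and odd closed walks *)

(** Induction on the size of [D]. A tight nonempty proper subset [S] is matched first and its
    neighbourhood is withdrawn from the rest. If there is none, every nonempty proper subset has a
    spare neighbour, so [a] may take any [t] in [e a]. *)
Lemma hall (A T : finType) (t0 : T) (e : A -> {set T}) (D : {set A}) :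
  (forall S : {set A}, S \subset D -> #|S| <= #|\bigcup_(x in S) e x|) ->
  exists f : A -> T, {in D &, injective f} /\ {in D, forall x, f x \in e x}.
Proof.
have [n] := ubnP #|D|; elim: n e D => // n IH e D /ltnSE-le_n hallD.
have [->|[a aD]] := set_0Vmem D.
  by exists (fun=> t0); split=> [x y|x]; rewrite inE.
case: (boolP [exists S : {set A},
    [&& S \proper D, S != set0 & #|\bigcup_(x in S) e x| <= #|S|]]).
  move=> /existsP[S /and3P[SD S0 tight]].
  have [sSD _] := andP SD.
  have [||f1 [inj1 f1e]] := IH e S.
  - exact: leq_trans (proper_card SD) le_n.
  - by move=> R RS; apply: hallD; apply: subset_trans sSD.
  have [||f2 [inj2 f2e]] := IH (fun x => e x :\: \bigcup_(y in S) e y) (D :\: S).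
  - apply: leq_trans le_n; apply: proper_card; rewrite properEneq subsetDl andbT.
    have [x xS] := set0Pn _ S0; apply/eqP => /setP /(_ x).
    by rewrite !inE xS (subsetP sSD).
  - move=> R /subsetDP[RD RS].
    have -> : \bigcup_(x in R) (e x :\: \bigcup_(y in S) e y) =
        (\bigcup_(x in R :|: S) e x) :\: \bigcup_(y in S) e y.
      apply/setP => t; rewrite inE; apply/bigcupP/andP => [[x xR]|[tS]].
        rewrite inE => /andP[tS tx]; split=> //; apply/bigcupP; exists x => //.
        by rewrite inE xR.
      move=> /bigcupP[x]; rewrite inE => /orP[xR|xS] tx; last first.
        by case/bigcupP: tS; exists x.
      by exists x; rewrite // inE tS.
    have := hallD (R :|: S); rewrite subUset RD sSD => /(_ isT).
    rewrite cardsU (disjoint_setI0 RS) cards0 subn0 cardsD (setIidPr _); last first.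
      by apply/bigcupsP => x xS; apply: (bigcup_sup x); rewrite // inE xS orbT.
    by move: tight; lia.
  exists (fun x => if x \in S then f1 x else f2 x).
  have cross x y : x \in D -> x \in S -> y \in D -> y \notin S -> f1 x <> f2 y.
    move=> xD xS yD yS E; have := f2e y; rewrite !inE yS yD => /(_ isT) /andP[].
    by rewrite -E => /bigcupP[]; exists x => //; apply: f1e.
  split=> [x y xD yD|x xD].
    case: ifPn => xS; case: ifPn => yS E.
    - exact: inj1 E.
    - by case: (cross x y).
    - by case: (cross y x).
    - by apply: inj2 E; rewrite inE ?xS ?yS.
  case: ifPn => xS; first exact: f1e.
  by have := f2e x; rewrite !inE xS xD => /(_ isT) /andP[].
move=> /existsPn loose.
have [t ta] : exists t, t \in e a.
  have := hallD [set a]; rewrite sub1set aD cards1 big_set1 => /(_ isT).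
  by rewrite card_gt0 => /set0Pn.
have [||f [injf fe]] := IH (fun x => e x :\ t) (D :\ a).
- by rewrite (cardsD1 a) aD in le_n.
- move=> R RDa; have [->|R0] := eqVneq R set0; first by rewrite cards0.
  have RD : R \proper D.
    rewrite properEneq (subset_trans RDa) ?subD1set // andbT.
    by apply: contraTneq RDa => ->; apply/subsetPn; exists a; rewrite // !inE eqxx.
  have := loose R; rewrite RD R0 /= -ltnNge => lt.
  have -> : \bigcup_(x in R) (e x :\ t) = (\bigcup_(x in R) e x) :\ t.
    apply/setP => s; rewrite !inE; apply/bigcupP/andP => [[x xR]|[st]].
      by rewrite !inE => /andP[-> sx]; split=> //; apply/bigcupP; exists x.
    by case/bigcupP=> x xR sx; exists x; rewrite // !inE st.
  by have := cardsD1 t (\bigcup_(x in R) e x); case: (_ \in _); lia.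
exists (fun x => if x == a then t else f x); split=> [x y xD yD|x xD].
  have off z : z \in D -> z != a -> f z != t.
    by move=> zD za; have := fe z; rewrite !inE za zD => /(_ isT) /andP[].
  case: eqP => [->|/eqP xa]; case: eqP => [->//|/eqP ya] E.
  - by have := off y yD ya; rewrite E eqxx.
  - by have := off x xD xa; rewrite E eqxx.
  - by apply: injf => //; rewrite !inE ?xa ?ya.
case: eqP => [->//|/eqP xa].
by have := fe x; rewrite !inE xa xD => /(_ isT) /andP[].
Qed.

(** One clique is coloured injectively; each vertex [a] of the other has the list [e a] of colours
    absent from its neighbours, and Hall's theorem picks distinct ones. *)
Lemma two_cliques_colorable (G : sgraph) (b : pred G) :
  (forall u v, b u = b v -> cadj u v) -> ~ contains G (complete_graph 6) ->
  colorable 5 G.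
Proof.
move=> cb noK6.
have small (A : {set G}) : {in A &, forall x y, cadj x y} -> #|A| <= 5.
  by move=> cA; rewrite leqNgt; apply/negP => /clique_contains /(_ cA).
pose B := [set u | b u].
have B5 : #|B| <= 5 by apply: small => u v; rewrite !inE => bu bv; apply: cb; rewrite bu bv.
pose cB u : 'I_5 := inord (index u (enum B)).
have cB_inj u v : b u -> b v -> cB u = cB v -> u = v.
  move=> bu bv /(congr1 val).
  have lt x : b x -> index x (enum B) < 5.
    by move=> bx; apply: leq_trans B5; rewrite cardE index_mem mem_enum inE.
  rewrite /= !inordK ?lt // => /index_inj; apply; by rewrite ?mem_enum ?inE.
pose e a := [set c | [forall u, (b u && cadj a u) ==> (cB u != c)]].
have [S|f [injf fe]] := @hall _ _ ord0 e (~: B).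
  move=> /subsetP SB.
  have nb u : u \in S -> b u = false by move=> /SB; rewrite !inE => /negbTE.
  (* [S] together with its common neighbours [Bs] is a clique, hence has at most 5 vertices. *)
  pose Bs := [set u | b u & [forall a in S, cadj a u]].
  have := small (S :|: Bs).
  rewrite cardsU (_ : S :&: Bs = set0); last first.
    by apply/setP => u; rewrite !inE; apply: negbTE; apply/negP => /and3P[/nb->].
  rewrite cards0 subn0 => le5.
  have {}le5 : #|S| + #|Bs| <= 5.
    apply: le5 => u v; rewrite !inE => /orP[uS|/andP[bu /forall_inP uS]]
      /orP[vS|/andP[bv /forall_inP vS]].
    - by apply: cb; rewrite !nb.
    - exact: vS.
    - by rewrite cadjC; apply: uS.
    - by apply: cb; rewrite bu bv.
  have [->|S0] := eqVneq S set0; first by rewrite cards0.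
  have sub : ~: (cB @: Bs) \subset \bigcup_(a in S) e a.
    apply/subsetP => c; rewrite inE => cBs.
    have [u /andP[bu /eqP uc]|none] := pickP [pred u | b u & cB u == c].
      have /forall_inPn[a aS au] : ~~ [forall a in S, cadj a u].
        by apply: contra cBs => H; rewrite -uc imset_f // inE bu.
      apply/bigcupP; exists a => //; rewrite inE; apply/forallP => v.
      apply/implyP => /andP[bv av]; apply: contraNneq au => vc.
      by rewrite -(cB_inj v u) // uc.
    have [a aS] := set0Pn _ S0; apply/bigcupP; exists a => //.
    rewrite inE; apply/forallP => v; apply/implyP => /andP[bv _].
    by have := none v; rewrite /= bv => /negbT.
  apply: leq_trans (subset_leq_card sub).
  rewrite -(leq_add2l #|cB @: Bs|) cardsC card_ord addnC.
  by apply: leq_trans le5; rewrite leq_add2l leq_imset_card.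
exists (fun u => if b u then cB u else f u) => u v uv.
have u_v := edge_neq uv.
have cross x y : b x -> b y = false -> cadj x y -> cB x != f y.
  move=> bx by' xy; have := fe y; rewrite !inE by' => /(_ isT) /forallP /(_ x).
  by rewrite bx cadjC xy.
case: ifP => bu; case: ifP => bv.
- by apply: contraNneq u_v => /cB_inj ->.
- by apply: cross; rewrite // /cadj uv orbT.
- by rewrite eq_sym cross // cadjC /cadj uv orbT.
- by apply: contraNneq u_v => /injf -> //; rewrite !inE ?bu ?bv.
Qed.

Definition odd_closed_walk (T : Type) (e : rel T) (L : nat) (w : nat -> T) :=
  [/\ odd L, w L = w 0 & forall i, i < L -> e (w i) (w i.+1)].

(** In the double cover [T * bool], a path joining the two copies of a vertex projects to an odd
    closed walk. Without such paths, the sheet reached from the root of the component is a proper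
    2-colouring. *)
Lemma bipartite_or_odd_walk (T : finType) (e : rel T) : symmetric e ->
  (exists b : pred T, forall u v, e u v -> b u != b v) \/
  (exists L w, odd_closed_walk e L w).
Proof.
move=> se; pose e2 := [rel u v : T * bool | e u.1 v.1 && (u.2 != v.2)].
have sc2 : connect_sym e2.
  by apply: sym_connect_sym => u v /=; rewrite se eq_sym.
have sc := sym_connect_sym se.
case: (boolP [exists x, connect e2 (x, false) (x, true)]) => [/existsP[x]|].
  move=> /connectP[p pp pl]; right; exists (size p).
  pose s := (x, false) :: p; pose w n := nth (x, false) s n.
  have step i : i < size p -> e2 (w i) (w i.+1) by move=> ip; apply: (pathP _ pp).
  have par i : i <= size p -> (w i).2 = odd i.
    elim: i => // i IH ip; have /andP[_] := step i ip; rewrite IH ?(ltnW ip) //=.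
    by case: (w i.+1).2; case: odd.
  have wl : w (size p) = (x, true) by rewrite pl; exact: (nth_last (x, false) s).
  exists (fun n => (w n).1); split; first by rewrite -par // wl.
    by rewrite wl.
  by move=> i /step /andP[].
move=> /existsPn no; left.
have lift x y b : connect e x y -> exists c, connect e2 (x, b) (y, c).
  move=> /connectP[p]; elim: p x b => [x b _ ->|z p IH x b /= /andP[xz zp] yE].
    by exists b.
  have [c zc] := IH z (~~ b) zp yE; exists c; apply: connect_trans zc.
  by apply: connect1; rewrite /= xz; case: b.
exists (fun x => connect e2 (root e x, false) (x, true)) => u v uv.
have -> : root e v = root e u.
  by apply/eqP; rewrite (root_connect sc) sc connect1.
have [c uc] : exists c, connect e2 (root e u, false) (u, c).
  by apply: lift; rewrite sc connect_root.
have vc : connect e2 (root e u, false) (v, ~~ c).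
  by apply: connect_trans uc _; apply: connect1; rewrite /= uv; case: (c).
have once x d : connect e2 (root e u, false) (x, d) ->
    connect e2 (root e u, false) (x, ~~ d) = false.
  move=> xd; apply/negP => xd'; case/negP: (no x); rewrite sc2 in xd.
  case: d xd xd' => /= xd xd'; last exact: connect_trans xd xd'.
  by rewrite sc2; apply: connect_trans xd xd'.
by case: c uc vc => /= uc vc; rewrite ?uc ?vc ?(once _ _ uc) ?(once _ _ vc).
Qed.

Lemma min_odd_walk (T : Type) (e : rel T) L w : odd_closed_walk e L w ->
  exists L' w', odd_closed_walk e L' w' /\
    forall L'' w'', odd_closed_walk e L'' w'' -> L' <= L''.
Proof.
have [n] := ubnP L; elim: n L w => // n IH L w /ltnSE-Ln W.
have [[L' [w' [W' lt]]]|no] :=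
    classic (exists L' w', odd_closed_walk e L' w' /\ L' < L).
  by apply: (IH L' w') => //; apply: leq_trans lt Ln.
exists L, w; split=> // L' w' W'; rewrite leqNgt; apply/negP => lt.
by apply: no; exists L', w'.
Qed.

Section MinimalOddWalk.

Variables (T : eqType) (e : rel T) (L : nat) (w : nat -> T).
Hypotheses (se : symmetric e) (W : odd_closed_walk e L w).
Hypothesis Lmin : forall L' w', odd_closed_walk e L' w' -> L <= L'.

(** A repeated vertex splits the walk into two shorter closed walks, one of which is odd. *)
Lemma min_walk_inj i j : i < j < L -> w i != w j.
Proof.
move=> /andP[ij jL]; have [oL wL we] := W; apply/eqP => E.
have [o|o] := boolP (odd (j - i)).
  have := @Lmin (j - i) (fun n => w (i + n)).
  suff H : odd_closed_walk e (j - i) (fun n => w (i + n)) by move=> /(_ H); lia.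
  split=> [//||n nj]; first by rewrite addn0 subnKC // ltnW.
  by rewrite addnS; apply: we; lia.
have := @Lmin (L - (j - i)) (fun n => if n < i then w n else w (n + (j - i))).
suff H : odd_closed_walk e (L - (j - i)) (fun n => if n < i then w n else w (n + (j - i))).
  by move=> /(_ H); lia.
split=> [||n nj] /=; first by rewrite oddB ?oL ?(negbTE o) //; lia.
  rewrite ifF ?subnK ?wL; try lia.
  by case: posnP => // i0; move: E; rewrite i0 subn0 add0n.
have [ni|ni] := ltnP n.+1 i; first by rewrite ltnW //; apply: we; lia.
have [ni'|ni'] := ltnP n i; last by rewrite addSn; apply: we; lia.
have -> : n.+1 + (j - i) = j by lia.
by rewrite -E (_ : i = n.+1); [apply: we; lia | lia].
Qed.

(** A chord closes both parts of the walk. Their lengths add up to [L + 2], so one is odd, and both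
    are below [L] since the chord joins no cyclically consecutive positions. *)
Lemma min_walk_chordless i j : i.+1 < j < L -> (i == 0) && (j == L.-1) = false ->
  e (w i) (w j) = false.
Proof.
move=> /andP[ij jL] out; have [oL wL we] := W; apply/negP => E.
have [o|o] := boolP (odd (j - i)); last first.
  have := @Lmin (j - i).+1 (fun n => if n == (j - i).+1 then w i else w (i + n)).
  suff H : odd_closed_walk e (j - i).+1 (fun n => if n == (j - i).+1 then w i else w (i + n)).
    by move=> /(_ H); lia.
  split=> [|/=|n nj /=]; first by rewrite /= o.
    by rewrite eqxx addn0.
  rewrite ltn_eqF // eqSS; case: eqP => [->|nj'].
    by rewrite subnKC 1?se //; lia.
  by rewrite addnS; apply: we; lia.
pose c n := if n <= i then w n else w (n + (j - i.+1)).
have := @Lmin (L - (j - i.+1)) c.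
suff H : odd_closed_walk e (L - (j - i.+1)) c by move=> /(_ H); lia.
split=> [||n nj]; rewrite /c.
- have oj : odd (j - i.+1) = false by lia.
  have jL' : j - i.+1 <= L by lia.
  by rewrite (oddB jL') oL oj.
- by rewrite leq0n ifF ?subnK ?wL //; lia.
have [ni|ni] := leqP n.+1 i; first by rewrite ltnW //; apply: we; lia.
have [ni'|ni'] := leqP n i; last by rewrite addSn; apply: we; lia.
by rewrite (_ : n.+1 + (j - i.+1) = j) 1?(_ : n = i) //; lia.
Qed.

End MinimalOddWalk.

(** * Odd holes of the complement *)

(** Each listed pair is a colour class and a vertex takes the first pair containing it; a diagonal
    pair [(x, x)] is a singleton class. *)
Lemma colorable_pairs (G : sgraph) k (ps : seq (G * G)) :
  size ps <= k -> all (fun p => ~~ (p.1 -- p.2)) ps ->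
  (forall x, has (fun p => (x == p.1) || (x == p.2)) ps) -> colorable k G.
Proof.
move=> sk /allP nadj cov; pose q x (p : G * G) := (x == p.1) || (x == p.2).
have lt x : find (q x) ps < k by apply: leq_trans sk; rewrite -has_find cov.
exists (fun x => Ordinal (lt x)) => x y xy; rewrite -val_eqE /=.
apply/eqP => E; have [p _] := hasP (cov x).
have qx := nth_find p (cov x); have := nth_find p (cov y).
rewrite -/(q y) -E; have := nadj (nth p ps (find (q x) ps)).
rewrite mem_nth => [/(_ isT)|]; last by rewrite -has_find; exact: cov.
move: qx; rewrite -/(q x).
case: (nth _ _ _) => a b /= /orP[] /eqP xE nab /orP[] /eqP yE;
  by move: xy nab; rewrite xE yE ?edge_irrefl // 1?edge_sym => ->.
Qed.

Fixpoint vecs n : seq (seq bool) :=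
  if n is m.+1 then [seq b :: s | b <- [:: true; false], s <- vecs m]
  else [:: [::]].

Lemma mem_vecs n (s : seq bool) : size s = n -> s \in vecs n.
Proof.
elim: n s => [|n IH] [|b s] //= [sn].
rewrite cats0 mem_cat; case: b; rewrite map_f ?orbT //; exact: IH.
Qed.

(* The neighbourhoods in an odd hole of length 7 of a vertex creating no
   closed walk of length 3 or 5. *)
Definition nbr_vec (X : seq bool) :=
  has id X && all (fun i => all (fun j =>
    [&& nth false X i, nth false X j & i < j] ==> (j - i \in [:: 2; 5]))
    (iota 0 7)) (iota 0 7).

Definition adj7 i j := (j == i.+1 %% 7) || (i == j.+1 %% 7).

Definition pairs7 := [seq (i, j) | i <- iota 0 7, j <- iota 0 7].

Definition triples7 := [seq t <- [seq (i, jk) | i <- iota 0 7, jk <- pairs7]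
  | let: (i, (j, k)) := t in
    [&& i < j, j < k, k < 7, ~~ adj7 i j, ~~ adj7 i k & ~~ adj7 j k]].

(** Positions [a], [b], [c] are partners for three outside vertices, while [p] and [r] start the two
    hole edges that cover the other four positions. *)
Definition matchings7 :=
  [seq t <- [seq (s, pr) | s <- [seq (a, bc) | a <- iota 0 7, bc <- pairs7],
                           pr <- pairs7]
  | let: ((a, (b, c)), (p, r)) := t in
    all (mem [:: a; b; c; p; p.+1 %% 7; r; r.+1 %% 7]) (iota 0 7) &&
    all (gtn 7) [:: a; b; c; p; r]].

(* The vertex with neighbourhood X can replace vertex i of the 7-hole, and the
   other two then have no neighbour on the new hole. *)
Definition swap7 (X Y Z : seq bool) i :=
  [&& nth false X (i.+1 %% 7), nth false X ((i + 6) %% 7) &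
    all (fun l => (l != i) ==> ~~ (nth false Y l || nth false Z l)) (iota 0 7)].

(** The outcomes are, in order, a clique on 6 vertices, a colouring by five nonadjacent pairs, and a
    7-hole leaving two vertices without nonneighbours on it. *)
Definition resolved7 (X Y Z : seq bool) :=
  [|| has (fun t => let: (i, (j, k)) := t in
        all (fun l => ~~ [|| nth false X l, nth false Y l | nth false Z l])
          [:: i; j; k]) triples7,
      has (fun t => let: ((a, (b, c)), (p, r)) := t in
        [&& nth false X a, nth false Y b & nth false Z c]) matchings7 |
      has (fun i => [|| swap7 X Y Z i, swap7 Y X Z i | swap7 Z X Y i])
        (iota 0 7)].

(** A finite check; rotating the hole allows the first vector to be true at 0. *)
Lemma resolved7_all : all (fun X => all (fun Y => all (resolved7 X Y)
    [seq V <- vecs 7 | nbr_vec V]) [seq V <- vecs 7 | nbr_vec V])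
  [seq V <- vecs 7 | nbr_vec V & nth false V 0].
Proof. by vm_compute. Qed.

Section OddHole.

Variables (T : eqType) (e : rel T) (L : nat).
Hypotheses (se : symmetric e) (ie : irreflexive e).
Hypothesis Lmin : forall L' w', odd_closed_walk e L' w' -> L <= L'.

Lemma odd_walk_ge3 w : odd_closed_walk e L w -> 2 < L.
Proof.
case=> oL wL we; case: L oL wL we => [|[|[|n]]] // _ w1 /(_ 0 isT).
by rewrite w1 ie.
Qed.

Lemma hole_inj w i j : odd_closed_walk e L w -> i < L -> j < L ->
  (w i == w j) = (i == j).
Proof.
move=> W; wlog ij : i j / i < j.
  move=> X iL jL; case: (ltngtP i j) => [ij|ij|->]; last by rewrite eqxx.
    by rewrite X // ltn_eqF.
  by rewrite eq_sym X // ltn_eqF.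
by move=> iL jL; rewrite (ltn_eqF ij) (negbTE (min_walk_inj W Lmin _)) ?ij.
Qed.

Lemma hole_edge w i j : odd_closed_walk e L w -> i < L -> j < L ->
  e (w i) (w j) = (j == i.+1 %% L) || (i == j.+1 %% L).
Proof.
move=> W; have L3 := odd_walk_ge3 W; have [oL wL we] := W.
have SE l : l < L -> l.+1 %% L = if l.+1 == L then 0 else l.+1.
  move=> lL; case: eqP => [->|lm]; first by rewrite modnn.
  by rewrite modn_small //; lia.
wlog ij : i j / i < j.
  move=> X iL jL; case: (ltngtP i j) => [ij|ij|->]; first exact: X.
    by rewrite se X // orbC.
  by rewrite ie SE //; case: (j.+1 =P L); lia.
move=> iL jL; rewrite !SE // (ltn_eqF (_ : i.+1 < L)); last lia.
have [->|ji] := eqVneq j i.+1; first by rewrite we.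
have [jL1|jL1] := eqVneq j.+1 L.
  have [->|i0] := posnP i; first by rewrite -wL -jL1 se we.
  by rewrite (min_walk_chordless se W Lmin) //; lia.
by rewrite (min_walk_chordless se W Lmin) //; lia.
Qed.

Lemma rotate_walk w j : odd_closed_walk e L w -> j < L -> exists w',
  [/\ odd_closed_walk e L w', w' 0 = w j &
    [seq w i | i <- iota 0 L] =i [seq w' i | i <- iota 0 L]].
Proof.
move=> W jL; have L3 := odd_walk_ge3 W; have [oL wL we] := W.
exists (fun n => w ((n + j) %% L)); split.
- split=> // [|n nL]; first by rewrite modnDl.
  have rL : (n + j) %% L < L by rewrite ltn_mod; lia.
  have -> : (n.+1 + j) %% L = ((n + j) %% L).+1 %% L.
    by rewrite addSn -[in LHS]addn1 -[in RHS]addn1 modnDml.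
  move: rL; set r := (n + j) %% L => rL.
  have [E|ne] := eqVneq r.+1 L; first by rewrite E modnn -wL -E we.
  by rewrite [r.+1 %% L]modn_small ?we // ltn_neqAle ne.
- by rewrite add0n modn_small.
move=> u; apply/mapP/mapP => -[i]; rewrite mem_iota add0n => /andP[_ iL] ->; last first.
  by exists ((i + j) %% L); rewrite // mem_iota add0n ltn_mod; lia.
exists ((i + (L - j)) %% L).
  by rewrite mem_iota add0n ltn_mod; lia.
by rewrite modnDml -addnA subnK ?(ltnW jL) // modnDr modn_small.
Qed.

End OddHole.

Section SmallIndependence.

Variable G : sgraph.
Hypothesis tri : forall a b c : G, [|| cadj a b, cadj a c | cadj b c].

Definition nonadj (x y : G) := ~~ cadj x y.

Local Notation hole L w := (odd_closed_walk nonadj L w).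
Local Notation on L w := [seq w i | i <- iota 0 L].

Lemma nonadjC : symmetric nonadj.
Proof. by move=> x y; rewrite /nonadj cadjC. Qed.

Lemma nonadjxx : irreflexive nonadj.
Proof. by move=> x; rewrite /nonadj cadjxx. Qed.

Lemma nonadjN x y : nonadj x y -> ~~ x -- y.
Proof. by case/norP. Qed.

Variable L : nat.
Hypothesis Lmin : forall L' w', hole L' w' -> L <= L'.

(** By minimality the hole induces in [G] exactly the complement of a cycle. *)
Lemma join_hole w (t : seq G) : hole L w -> uniq t ->
  {in t &, forall x y, cadj x y} ->
  {in t, forall x i, i < L -> ~~ nonadj x (w i)} ->
  contains G (join_graph (compl_graph (cycle_graph L)) (complete_graph (size t))).
Proof.
move=> W ut ct tw; have L3 := odd_walk_ge3 nonadjxx W.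
have wE := hole_edge nonadjC nonadjxx Lmin W; have wI := hole_inj Lmin W.
pose f (u : 'I_L + 'I_(size t)) :=
  match u with inl i => w i | inr j => nth (w 0) t j end.
(* A hole vertex misses its successor on the hole, whereas members of [t] miss nothing there. *)
have off (i : 'I_L) (j : 'I_(size t)) : w i != nth (w 0) t j.
  apply/eqP => E; have iL : i.+1 %% L < L by rewrite ltn_mod; lia.
  have := tw _ (mem_nth (w 0) (ltn_ord j)) _ iL.
  by rewrite -E wE // eqxx.
have f_inj : injective f.
  move=> [i|i] [j|j] /= /eqP.
  - by rewrite wI // => /eqP /val_inj ->.
  - by rewrite (negbTE (off _ _)).
  - by rewrite eq_sym (negbTE (off _ _)).
  - by rewrite nth_uniq // => /eqP /val_inj ->.
exists f; split=> // u v uv.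
have u_v : u != v by case/andP: uv.
rewrite edge_cadj (inj_eq f_inj) u_v -[cadj _ _]negbK -/(nonadj _ _) /=.
case: u v uv u_v => [i|i] [j|j] uv u_v /=.
- have ncyc : ~~ ((i : cycle_graph L) -- j).
    by case/andP: uv => _ /orP[] /andP[_] /orP[] //; rewrite edge_sym.
  have ij : i != j by apply: contra_neq u_v => ->.
  by move: ncyc; rewrite wE //= ij -!val_eqE.
- by rewrite nonadjC tw // mem_nth.
- by rewrite tw // mem_nth.
- by rewrite /nonadj negbK ct ?mem_nth.
Qed.

End SmallIndependence.

(** * Colouring around a hole of length 7 or 9 in the complement *)

Ltac cover_pairs cov :=
  let u := fresh "u" in intro u; move: (cov u); rewrite /= !inE;
  repeat (case: (u == _); rewrite ?orbT //=).

Section Leftover.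

Variable G : sgraph.
Hypothesis tri : forall a b c : G, [|| cadj a b, cadj a c | cadj b c].
Hypothesis noK6 : ~ contains G (complete_graph 6).

Local Notation e := (@nonadj G).
Local Notation hole L w := (odd_closed_walk e L w).
Local Notation on L w := [seq w i | i <- iota 0 L].

Definition touches L (w : nat -> G) x := has (fun i => e x (w i)) (iota 0 L).

Lemma touchesP L w x i : ~~ touches L w x -> i < L -> ~~ e x (w i).
Proof. by move=> /hasPn H iL; apply: H; rewrite mem_iota. Qed.

Lemma touches_mem L w x u : e x u -> u \in on L w -> touches L w x.
Proof. by move=> xu /mapP[i iL E]; apply/hasP; exists i; rewrite // -E. Qed.

Lemma touches_rotate L w x s :
  (forall L' w', hole L' w' -> L <= L') -> hole L w ->
  (forall u, u \in on L w ++ s) -> touches L w x ->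
  exists w', [/\ hole L w', e x (w' 0) & forall u, u \in on L w' ++ s].
Proof.
move=> Lmin W cov /hasP[j]; rewrite mem_iota add0n => /andP[_ jL] xj.
have [w' [W' w'0 sub]] := rotate_walk (@nonadjxx G) W jL.
exists w'; split=> // [|u]; first by rewrite w'0.
by have := cov u; rewrite !mem_cat sub.
Qed.

Lemma no_hole3 w : hole 3 w -> False.
Proof.
case=> _ w3 we; have := tri (w 0) (w 1) (w 2).
have := we 2 isT; rewrite w3 => /negbTE; rewrite cadjC => ->.
by rewrite (negbTE (we 0 isT)) (negbTE (we 1 isT)).
Qed.

Lemma no_hole5 w : C5_free G -> (forall L' w', hole L' w' -> 5 <= L') ->
  hole 5 w -> False.
Proof.
move=> c5 Lmin W; have := hole_edge (@nonadjC G) (@nonadjxx G) Lmin W.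
have wI := hole_inj Lmin W => wE.
have ed i j : i < 5 -> j < 5 -> i != j ->
    (j == i.+1 %% 5) || (i == j.+1 %% 5) = false -> w i -- w j.
  move=> i5 j5 ij nij; rewrite edge_cadj wI // ij.
  by have := wE i j i5 j5; rewrite nij => /negbFE.
have no i j : i < 5 -> j < 5 -> (j == i.+1 %% 5) || (i == j.+1 %% 5) ->
    cadj (w i) (w j) = false.
  by move=> i5 j5 nij; apply: negbTE; have := wE i j i5 j5; rewrite nij.
(* The complement of a 5-cycle is again a 5-cycle, traversed in steps of two. *)
have := @c5 (w 0) (w 2) (w 4) (w 1) (w 3).
by rewrite !ed // !no // => /(_ isT isT isT isT isT).
Qed.

(** If the extra vertex misses some hole vertex, it is paired with it and the other eight pair up
    along the hole; otherwise it forms the forbidden join. *)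
Lemma hole9_colorable w s : (forall L' w', hole L' w' -> 9 <= L') ->
  hole 9 w -> (forall u, u \in on 9 w ++ s) -> size s <= 1 ->
  ~ contains G (join_graph (compl_graph (cycle_graph 9)) (complete_graph 1)) ->
  colorable 5 G.
Proof.
move=> Lmin W cov; case: s cov => [|x [|//]] cov _ no.
  have [_ _ we] := W.
  apply: (@colorable_pairs _ 5 [:: (w 0, w 1); (w 2, w 3); (w 4, w 5); (w 6, w 7);
    (w 8, w 8)]) => //; last by cover_pairs cov.
  by rewrite /= !(nonadjN (we _ _)) // edge_irrefl.
have [/(touches_rotate Lmin W cov) [v [[_ _ ve] xv {}cov]]|nx] := boolP (touches 9 w x).
  apply: (@colorable_pairs _ 5 [:: (x, v 0); (v 1, v 2); (v 3, v 4); (v 5, v 6);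
    (v 7, v 8)]) => //; last by cover_pairs cov.
  by rewrite /= (nonadjN xv) !(nonadjN (ve _ _)).
case: no; apply: (join_hole Lmin W (t := [:: x])) => // [u v|u].
  by rewrite !inE => /eqP-> /eqP->; apply: cadjxx.
by rewrite inE => /eqP-> i i9; apply: touchesP nx i9.
Qed.

Hypothesis Lmin : forall L' w', hole L' w' -> 7 <= L'.
Hypothesis no72 :
  ~ contains G (join_graph (compl_graph (cycle_graph 7)) (complete_graph 2)).

Lemma no_untouched_pair w y z : hole 7 w -> y -- z -> ~~ touches 7 w y ->
  ~~ touches 7 w z -> False.
Proof.
move=> W yz ny nz; apply: no72; apply: (join_hole Lmin W (t := [:: y; z])).
- by rewrite /= inE andbT edge_neq.
- have c : cadj y z by rewrite /cadj yz orbT.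
  move=> u v; rewrite !inE => /orP[]/eqP-> /orP[]/eqP->; rewrite ?cadjxx //.
  by rewrite cadjC.
- by move=> u; rewrite !inE => /orP[]/eqP-> i; apply: touchesP.
Qed.

Lemma hole7_one_left w x : hole 7 w -> (forall u, u \in on 7 w ++ [:: x]) ->
  colorable 5 G.
Proof.
move=> [_ _ we] cov.
apply: (@colorable_pairs _ 5 [:: (w 0, w 1); (w 2, w 3); (w 4, w 5);
  (w 6, w 6); (x, x)]) => //; last by cover_pairs cov.
by rewrite /= !(nonadjN (we _ _)) // !edge_irrefl.
Qed.

Lemma hole7_two_left w x y : hole 7 w -> x != y ->
  (forall u, u \in on 7 w ++ [:: x; y]) -> colorable 5 G.
Proof.
move=> W xy cov; have [_ _ we] := W.
have [c|c] := boolP (cadj x y); last first.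
  apply: (@colorable_pairs _ 5 [:: (w 0, w 1); (w 2, w 3); (w 4, w 5);
    (w 6, w 6); (x, y)]) => //; last by cover_pairs cov.
  by rewrite /= !(nonadjN (we _ _)) // edge_irrefl (nonadjN c).
have [/(touches_rotate Lmin W cov) [v [[_ _ ve] xv {}cov]]|nx] := boolP (touches 7 w x).
  apply: (@colorable_pairs _ 5 [:: (x, v 0); (v 1, v 2); (v 3, v 4); (v 5, v 6);
    (y, y)]) => //; last by cover_pairs cov.
  by rewrite /= (nonadjN xv) !(nonadjN (ve _ _)) // edge_irrefl.
have [/(touches_rotate Lmin W cov) [v [[_ _ ve] yv {}cov]]|ny] := boolP (touches 7 w y).
  apply: (@colorable_pairs _ 5 [:: (y, v 0); (v 1, v 2); (v 3, v 4); (v 5, v 6);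
    (x, x)]) => //; last by cover_pairs cov.
  by rewrite /= (nonadjN yv) !(nonadjN (ve _ _)) // edge_irrefl.
by case: (no_untouched_pair W _ nx ny); rewrite edge_cadj xy.
Qed.

(** If [z] touches the hole, it is paired there and [x] with [y]. Otherwise its nonneighbour is,
    say, [x]: then [z] is paired with [x], and [y] must touch the hole, since [y] and [z] are
    adjacent and would else form the forbidden join. *)
Lemma hole7_three_left_nonadj w x y z : hole 7 w -> x != y -> x != z -> y != z ->
  (forall u, u \in on 7 w ++ [:: x; y; z]) -> e x y -> (exists u, e z u) ->
  colorable 5 G.
Proof.
move=> W xy xz yz cov exy [u zu].
have [/(touches_rotate Lmin W cov) [v [[_ _ ve] zv {}cov]]|nz] := boolP (touches 7 w z).
  apply: (@colorable_pairs _ 5 [:: (z, v 0); (v 1, v 2); (v 3, v 4); (v 5, v 6);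
    (x, y)]) => //; last by cover_pairs cov.
  by rewrite /= (nonadjN zv) !(nonadjN (ve _ _)) // (nonadjN exy).
wlog ux : u x y xy xz yz cov exy zu / u = x.
  move=> X; have := cov u; rewrite mem_cat => /orP[/(touches_mem zu)|].
    by rewrite (negbTE nz).
  rewrite !inE => /or3P[]/eqP uE; first exact: (X u x y).
    apply: (X u y x) => //; [by rewrite eq_sym| |by rewrite nonadjC].
    move=> v; move: (cov v); rewrite !mem_cat !inE.
    by rewrite [(v == x) || _]orbCA.
  by move: zu; rewrite uE nonadjxx.
rewrite ux in zu.
have [/(touches_rotate Lmin W cov) [v [[_ _ ve] yv {}cov]]|ny] := boolP (touches 7 w y).
  apply: (@colorable_pairs _ 5 [:: (y, v 0); (v 1, v 2); (v 3, v 4); (v 5, v 6);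
    (z, x)]) => //; last by cover_pairs cov.
  by rewrite /= (nonadjN yv) !(nonadjN (ve _ _)) // (nonadjN zu).
case: (no_untouched_pair W _ ny nz); rewrite edge_cadj yz.
have := tri x y z; rewrite (negbTE exy) cadjC.
by rewrite [cadj z x](negbTE zu) // cadjC.
Qed.

(** Two nonneighbours of [x] at cyclic distance 1 or 3 on the hole would close an odd walk of length
    3 or 5 through [x]. *)
Lemma nbr_vecP w x : hole 7 w -> touches 7 w x ->
  nbr_vec (mkseq (fun i => e x (w i)) 7).
Proof.
move=> W xw; have wE := hole_edge (@nonadjC G) (@nonadjxx G) Lmin W.
have [_ _ we] := W; apply/andP; split.
  case/hasP: xw => i; rewrite mem_iota => iL xi.
  by apply/hasP; exists (e x (w i)) => //; apply/mapP; exists i; rewrite ?mem_iota.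
apply/allP => i; rewrite mem_iota => /andP[_ i7].
apply/allP => j; rewrite mem_iota => /andP[_ j7].
apply/implyP; rewrite !nth_mkseq // => /and3P[xi xj ij].
have jx : e (w j) x by rewrite nonadjC.
have ix : e (w i) x by rewrite nonadjC.
rewrite !inE; apply/norP => -[d2 d5].
have no3 : ~~ ((j == i.+1 %% 7) || (i == j.+1 %% 7)).
  rewrite -wE //; apply/negP => wij.
  suff /Lmin : hole 3 (nth x [:: x; w i; w j; x]) by [].
  by split=> // -[|[|[|]]].
have no5 k l m n : [/\ k < 7, l < 7, m < 7 & n < 7] -> l = k.+1 %% 7 ->
    m = l.+1 %% 7 -> n = m.+1 %% 7 -> e x (w k) -> e (w n) x -> False.
  move=> [k7 l7 m7 n7] lE mE nE xk nx.
  suff /Lmin : hole 5 (nth x [:: x; w k; w l; w m; w n; x]) by [].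
  split=> // -[|[|[|[|[|]]]]] //= _; rewrite wE //.
  - by rewrite lE eqxx.
  - by rewrite mE eqxx.
  - by rewrite nE eqxx.
(* A difference of 4 is cyclic distance 3, walked from [j] round to [i]. *)
have /orP[/eqP d3|/eqP d4] : (j == i + 3) || (j == i + 4) by lia.
  by apply: (no5 i i.+1 i.+2 j) => //; [split | ..]; lia.
by apply: (no5 j (j.+1 %% 7) (j.+2 %% 7) i) => //; [split | ..]; lia.
Qed.

(** With [x] in place of vertex [i] the hole remains a hole; [y] and [z], adjacent to [x] and to
    each other, would then give the forbidden join. *)
Lemma no_swap w x y z i : hole 7 w -> i < 7 -> cadj x y -> cadj x z -> y -- z ->
  swap7 (mkseq (fun i => e x (w i)) 7) (mkseq (fun i => e y (w i)) 7)
    (mkseq (fun i => e z (w i)) 7) i = false.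
Proof.
move=> W i7 xy xz yz; apply/negP; rewrite /swap7.
rewrite !nth_mkseq ?ltn_mod // => /and3P[x1 x6 /allP far].
have wE := hole_edge (@nonadjC G) (@nonadjxx G) Lmin W.
pose v n := if n %% 7 == i then x else w (n %% 7).
have V : hole 7 v.
  split=> // n n7; rewrite /v (modn_small n7).
  have [->|ni] := eqVneq n i.
    by rewrite ifF //; lia.
  have [n1|n1] := eqVneq (n.+1 %% 7) i.
    by rewrite nonadjC (_ : n = (i + 6) %% 7) //; lia.
  by rewrite wE ?eqxx // ltn_mod.
have untouched u : cadj x u -> (forall l, l < 7 -> l != i -> ~~ e u (w l)) ->
    ~~ touches 7 v u.
  move=> xu ul; apply/hasPn => l; rewrite mem_iota /= => l7; rewrite /v modn_small //.
  by case: eqP => [_|/eqP]; [rewrite nonadjC /nonadj xu | exact: ul].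
apply: (no_untouched_pair V yz); apply: untouched => // l l7 li.
  have := far l; rewrite mem_iota l7 li !nth_mkseq // => /(_ isT).
  by case/norP.
have := far l; rewrite mem_iota l7 li !nth_mkseq // => /(_ isT).
by case/norP.
Qed.

Lemma pairwise_contains (s : seq G) :
  pairwise (@edge G) s -> contains G (complete_graph (size s)).
Proof.
case: s => [_|x0 s0]; 
  first by exists (fun i : 'I_0 => False_rect G (notF (valP i))); split=> -[].
set s := x0 :: s0 => /(pairwiseP x0) ps.
have adj (i j : 'I_(size s)) : i < j -> nth x0 s i -- nth x0 s j.
  by apply: ps; rewrite inE /= ltn_ord.
exists (fun i : 'I_(size s) => nth x0 s i).
have adj' (i j : 'I_(size s)) : i != j -> nth x0 s i -- nth x0 s j.
  rewrite -val_eqE neq_ltn => /orP[|]; first exact: adj.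
  by rewrite edge_sym; apply: adj.
split=> [i j E|i j /andP[ij _]]; last exact: adj'.
by apply: contraTeq isT => /adj'; rewrite E edge_irrefl.
Qed.

(** As [x], [y], [z] are pairwise adjacent, the nonneighbours of each lie on the hole. The finite
    table then applies to their three vectors. *)
Lemma hole7_three_left w x y z : hole 7 w -> x -- y -> x -- z -> y -- z ->
  (forall u, u \in on 7 w ++ [:: x; y; z]) ->
  x \notin on 7 w -> y \notin on 7 w -> z \notin on 7 w ->
  (forall u, exists v, e u v) -> colorable 5 G.
Proof.
move=> W xy xz yz cov xw yw zw nonuniv.
have c (u v : G) : u -- v -> cadj u v by rewrite /cadj => ->; rewrite orbT.
have tch (v : nat -> G) u : (forall u, u \in on 7 v ++ [:: x; y; z]) ->
    cadj u x -> cadj u y -> cadj u z -> touches 7 v u.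
  move=> covv ux uy uz; have [t ut] := nonuniv u.
  have := covv t; rewrite mem_cat => /orP[|]; first exact: touches_mem.
  by rewrite !inE => /or3P[]/eqP tE; move: ut; rewrite tE /nonadj ?ux ?uy ?uz.
have /hasP[j] := tch w x cov (cadjxx x) (c _ _ xy) (c _ _ xz).
rewrite mem_iota add0n => /andP[_ j7] xj.
have [v [V v0 vw]] := rotate_walk (@nonadjxx G) W j7.
have {}cov u : u \in on 7 v ++ [:: x; y; z] by have := cov u; rewrite !mem_cat vw.
move: xw yw zw; rewrite !vw => xv yv zv; rewrite -v0 in xj.
have tx := tch v x cov (cadjxx x) (c _ _ xy) (c _ _ xz).
have ty := tch v y cov; rewrite cadjC (c _ _ xy) cadjxx (c _ _ yz) in ty.
have {}ty := ty isT isT isT.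
have tz := tch v z cov; rewrite ![cadj z _]cadjC (c _ _ xz) cadjxx (c _ _ yz) in tz.
have {}tz := tz isT isT isT.
have vE := hole_edge (@nonadjC G) (@nonadjxx G) Lmin V.
have vI := hole_inj Lmin V.
have size7 f : size (mkseq f 7 : seq bool) = 7 by rewrite size_mkseq.
have := resolved7_all => /allP /(_ (mkseq (fun i => e x (v i)) 7)).
rewrite mem_filter (nbr_vecP V tx) mem_vecs ?size7 // nth_mkseq // xj => /(_ isT).
move=> /allP /(_ (mkseq (fun i => e y (v i)) 7)).
rewrite mem_filter (nbr_vecP V ty) mem_vecs ?size7 // => /(_ isT).
move=> /allP /(_ (mkseq (fun i => e z (v i)) 7)).
rewrite mem_filter (nbr_vecP V tz) mem_vecs ?size7 // => /(_ isT).
case/or3P => /hasP[].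
- move=> [i [j' k]]; rewrite mem_filter => /andP[/and5P[ij jk k7 aij /andP[aik ajk]] _].
  have j7' := ltn_trans jk k7; have i7 := ltn_trans ij j7'.
  have vv l m : l < 7 -> m < 7 -> l < m -> ~~ adj7 l m -> v l -- v m.
    move=> l7 m7 lm; rewrite /adj7 -vE // negbK edge_cadj vI // => ->.
    by rewrite ltn_eqF.
  have uv u l : u \notin on 7 v -> l < 7 -> ~~ e u (v l) -> u -- v l.
    move=> nu l7; rewrite negbK edge_cadj => ->; rewrite andbT.
    by apply: contraNneq nu => ->; apply/mapP; exists l; rewrite ?mem_iota.
  rewrite /= !nth_mkseq // => /and4P[/norP[xi /norP[yi zi]]
    /norP[xj' /norP[yj zj]] /norP[xk /norP[yk zk]] _].
  case: noK6; apply: (@pairwise_contains [:: x; y; z; v i; v j'; v k]).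
  by rewrite /= xy xz yz !(uv x) // !(uv y) // !(uv z) // !vv // (ltn_trans ij).
- move=> [[a [b d]] [p r]]; rewrite mem_filter => /andP[/andP[/allP mem7]].
  rewrite [X in X -> _]/= => /and5P[a7 b7 d7 p7 /andP[r7 _]] _.
  rewrite !nth_mkseq // => /and3P[xa yb zd].
  apply: (@colorable_pairs _ 5 [:: (x, v a); (y, v b); (z, v d);
    (v p, v (p.+1 %% 7)); (v r, v (r.+1 %% 7))]) => //.
    rewrite /= (nonadjN xa) (nonadjN yb) (nonadjN zd).
    by rewrite !nonadjN // vE ?ltn_mod ?eqxx.
  move=> u; have := cov u; rewrite mem_cat => /orP[/mapP[i i7 ->]|].
    have := mem7 i i7; rewrite !inE /=.
    by do !(case: (_ =P _ :> nat) => [->|_]; rewrite ?eqxx ?orbT //).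
  by rewrite !inE => /or3P[]/eqP->; rewrite /= eqxx ?orbT.
move=> i; rewrite mem_iota => /andP[_ i7].
rewrite !no_swap // ?c //; by rewrite edge_sym.
Qed.

End Leftover.

(** * Independence number at most two: assembling the cases *)

Lemma max_degree_nonadj (G : sgraph) (x : G) :
  max_degree G <= #|G|.-2 -> 1 < #|G| -> exists y, nonadj x y.
Proof.
move=> deg G1; apply: NNPP => none.
have : degree x <= #|G|.-2 by apply: leq_trans deg; apply: (leq_bigmax x).
have -> : degree x = #|[set~ x]|.
  apply: eq_card => y; rewrite !inE edge_cadj eq_sym andbC.
  by case: (boolP (cadj x y)) => // nxy; case: none; exists y.
by rewrite cardsC1; lia.
Qed.

Lemma small_independence_colorable (G : sgraph) :
  (forall a b c : G, [|| cadj a b, cadj a c | cadj b c]) -> C5_free G ->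
  ~ contains G (complete_graph 6) ->
  ~ contains G (join_graph (compl_graph (cycle_graph 7)) (complete_graph 2)) ->
  ~ contains G (join_graph (compl_graph (cycle_graph 9)) (complete_graph 1)) ->
  #|G| <= 10 -> max_degree G <= 8 -> colorable 5 G.
Proof.
move=> tri c5 noK6 no72 no91 G10 deg.
have [[b bP]|[L0 [w0 W0]]] := bipartite_or_odd_walk (@nonadjC G).
  apply: (two_cliques_colorable (b := b)) noK6 => u v; apply: contra_eqT.
  exact: bP.
have [L [w [W Lmin]]] := min_odd_walk W0.
have L3 := odd_walk_ge3 (@nonadjxx G) W.
set W1 := [seq w i | i <- iota 0 L].
pose s := [seq u <- enum G | u \notin W1].
have uW : uniq W1.
  rewrite map_inj_in_uniq ?iota_uniq // => i j; rewrite !mem_iota => iL jL /eqP.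
  by rewrite (hole_inj Lmin W) // => /eqP.
have us : uniq s by rewrite filter_uniq // enum_uniq.
have sW u : u \in s -> u \notin W1 by rewrite mem_filter => /andP[].
have cov u : u \in W1 ++ s.
  by rewrite mem_cat mem_filter mem_enum andbT orbN.
have card : #|G| = L + size s.
  have u1 : uniq (W1 ++ s).
    by rewrite cat_uniq uW us andbT /= -all_predC; apply/allP => u /sW.
  rewrite -[L](size_iota 0) -(size_map w) -size_cat -(card_uniqP u1).
  by apply: eq_card => u; rewrite cov.
have oL : odd L by case: W.
have s10 : L + size s <= 10 by rewrite -card.
have [L3'|L3'] := eqVneq L 3.
  by subst L; case: (no_hole3 tri W).
have [L5|L5] := eqVneq L 5.
  by subst L; case: (no_hole5 c5 Lmin W).
have [L9|L9] := eqVneq L 9.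
  subst L; apply: (hole9_colorable Lmin W cov) no91.
  by rewrite -(leq_add2l 9).
have L7 : L = 7.
  have : L <= 10 by apply: leq_trans s10; apply: leq_addr.
  move: L3 L3' L5 L9 oL; clear.
  by case: L => [|[|[|[|[|[|[|[|[|[|[|L]]]]]]]]]]].
subst L; move: sW us cov card s10; rewrite /W1; clearbody s.
case: s => [|x [|y [|z [|t s]]]] sW us cov card s10; last by move: s10.
(* With nothing left over, a hole vertex stands in for the extra one. *)
- apply: (hole7_one_left (x := w 0) W) => u; have := cov u.
  by rewrite cats0 mem_cat => ->.
- exact: hole7_one_left W cov.
- apply: (hole7_two_left Lmin no72 W _ cov).
  by move: us; rewrite /= inE andbT.
move: us; rewrite /= !inE negb_or andbT => /andP[/andP[xy xz] yz].
(* Here the order is 10, and the degree bound 8 excludes a vertex adjacent to all others. *)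
have nonuniv (u : G) : exists v, nonadj u v.
  by apply: max_degree_nonadj; rewrite card.
have [cxy|nxy] := boolP (cadj x y); last first.
  exact: (hole7_three_left_nonadj tri Lmin no72 W xy xz yz cov nxy (nonuniv z)).
have [cxz|nxz] := boolP (cadj x z); last first.
  apply: (hole7_three_left_nonadj tri Lmin no72 W xz xy _ _ nxz (nonuniv y)).
    by rewrite eq_sym.
  move=> u; move: (cov u); rewrite !mem_cat !inE.
  by rewrite [(u == y) || _]orbC.
have [cyz|nyz] := boolP (cadj y z); last first.
  apply: (hole7_three_left_nonadj tri Lmin no72 W yz _ _ _ nyz (nonuniv x)).
  - by rewrite eq_sym.
  - by rewrite eq_sym.
  move=> u; move: (cov u); rewrite !mem_cat !inE.
  by rewrite [(u == x) || _]orbC -[(_ || _) || (u == x)]orbA.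
apply: (hole7_three_left noK6 Lmin no72 W _ _ _ cov) => //.
- by rewrite edge_cadj xy.
- by rewrite edge_cadj xz.
- by rewrite edge_cadj yz.
- by apply: sW; rewrite !inE eqxx.
- by apply: sW; rewrite !inE eqxx orbT.
- by apply: sW; rewrite !inE eqxx !orbT.
Qed.

Lemma independence_number2 (G : sgraph) (a b : G) :
  (forall a b c : G, [|| cadj a b, cadj a c | cadj b c]) -> nonadj a b ->
  independence_number G = 2.
Proof.
move=> tri /norP[a_b nab]; apply/eqP; rewrite eqn_leq; apply/andP; split.
  apply/bigmax_leqP => S /forall_inP indS; rewrite leqNgt; apply/negP.
  case/card_gt2P => x [y [z [[xS yS zS] [xy yz zx]]]].
  have nadj u v : u \in S -> v \in S -> u != v -> cadj u v = false.
    move=> uS vS uv; have /forall_inP /(_ v vS) := indS u uS.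
    by rewrite /cadj (negbTE uv) => /negbTE.
  by have := tri x y z; rewrite !nadj // eq_sym.
(* The number 2 is written as the cardinal of the set of [a] and [b]. *)
rewrite -[2]/(true.+1) -a_b -cards2.
apply: (@leq_bigmax_cond _ (@independent G) (fun S => #|S|)).
apply/forall_inP => x; rewrite !inE => /orP[]/eqP->; apply/forall_inP => y;
  rewrite !inE => /orP[]/eqP->; rewrite ?edge_irrefl //; by rewrite edge_sym.
Qed.

Theorem theorem1p8 (G : sgraph)
    (Gconn : connected G)
    (Gbull : ~ contains_induced G bull)
    (Gclaw : ~ contains_induced G claw)
    (GC5 : ~ contains_induced G (cycle_graph 5)) :
  contains G (complete_graph 6) \/
  contains G (join_graph (compl_graph (cycle_graph 7)) (complete_graph 2)) \/
  contains G (join_graph (compl_graph (cycle_graph 9)) (complete_graph 1)) \/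
  (independence_number G = 2 /\ 11 <= #|G|) \/
  (independence_number G = 2 /\ 9 <= max_degree G) \/
  (exists (n : nat) (k : 'I_(2 * n + 1) -> nat),
    [/\ 1 <= n, forall i, 0 < k i,
        isomorphic G (clique_expansion k) &
        5 * n < \sum_i k i]) \/
  colorable 5 G.
Proof.
have [?|noK6] := classic (contains G (complete_graph 6)); first by left.
right.
have [?|no72] := classic (contains G
  (join_graph (compl_graph (cycle_graph 7)) (complete_graph 2))); first by left.
right.
have [?|no91] := classic (contains G
  (join_graph (compl_graph (cycle_graph 9)) (complete_graph 1))); first by left.
right.
have clawG := claw_freeP Gclaw; have bullG := bull_freeP Gbull.
have [[a [b [c abc]]]|no3] := classic (exists a b c : G,
    ~~ [|| cadj a b, cadj a c | cadj b c]).
  have [k [phi [k5 phiE surj]]] := triple_expansion clawG bullG Gconn abc.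
  by have := expansion_alternative k5 phiE surj noK6; do 2!right.
have tri (a b c : G) : [|| cadj a b, cadj a c | cadj b c].
  by apply/negPn/negP => abc; apply: no3; exists a, b, c.
have [[a [b nab]]|complete] := classic (exists a b : G, nonadj a b); last first.
  (* A complete graph is a pair of cliques with one of them empty. *)
  do 3!right; apply: (two_cliques_colorable (b := predT)) noK6 => u v _.
  by apply/negPn/negP => uv; apply: complete; exists u, v.
have ind2 := independence_number2 tri nab.
have [G10|G11] := leqP #|G| 10; last by left.
have [deg|deg] := leqP (max_degree G) 8; last by right; left.
by do 3!right; apply: small_independence_colorable => //; apply: C5_freeP.
Qed.
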